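(* Let $d\ge1$, $n\ge2$, $q\in(0,1)$, and consider the discrete-time multi-hop model on the torus $\mathcal{T}_n$ described in the context, with service algorithm (D1) or (D2). Denote by $\xi$ a random variable with the distribution of $\xi_i(k)$ (for any $i$ and $k$). Assume that $\mathbb{E}(\xi^2)<\infty$ and $\mathbb{E}(\xi)=\lambda q$ with $\lambda<\frac{1}{2d+1}$. Let $X^{(n)}$ denote the stationary number of messages in queue $0$. Then $$\mathbb{E}(X^{(n)})\ \le\ \frac{\mathbb{E}(\xi^2)+2d(1-q)\lambda+\lambda-2\lambda^2q^2}{2q\left(\frac{1}{2d+1}-\lambda\right)}.$$
   Context: Torus. $\mathcal{T}_n=\{i\in\mathbb{Z}^d: i_k\in\{-n,\dots,n-1\}\ \forall k\}$ with coordinates taken modulo $2n$; nodes are adjacent if they are connected by one edge of the lattice (wrapped around), so $\mathcal{T}_n$ is a $2d$-regular graph. $\mathcal{N}_i$ is the set consisting of $i$ and its $2d$ adjacent nodes. The service rates are $\psi_i(\bar x)=x_i/\sum_{j\in\mathcal{N}_i}x_j$, with $0/0:=0$. Dynamics. The state $\bar X(k)\in\mathbb{Z}_+^{\mathcal{T}_n}$ evolves as $$X_i(k+1)=X_i(k)+\xi_i(k)+\sum_{j\in\mathcal{N}_i,\,j\ne i}I_{ji}(k)\eta_j(k)-\eta_i(k).$$ The exogenous arrivals $\xi_i(k)$ are $\mathbb{Z}_+$-valued and i.i.d. over $i$ and $k$. $\eta_i(k)\in\{0,1\}$ indicates a service completion at node $i$ in slot $k$. After a service completion at node $j$ the job leaves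 the system with probability $q$, or moves to an adjacent node $i$, each chosen with probability $(1-q)/(2d)$; $I_{ji}(k)$ indicates the choice of destination $i$. Routing choices are independent over nodes and slots and of everything else. Services. They are driven by $U_i(k)$, i.i.d. over $i,k$, uniform on $[0,1]$, independent of arrivals and routing, by one of two algorithms: (D1) let $\tau_i(k)=[-\log U_i(k)]/X_i(k)$ ($=\infty$ if $X_i(k)=0$); node $i$ serves a job in slot $k$ iff $X_i(k)>0$ and $\tau_i(k)<\tau_j(k)$ for all $j\in\mathcal{N}_i\setminus\{i\}$; (D2) node $i$ serves a job in slot $k$ iff $X_i(k)>0$ and $U_i(k)<\psi_i(\bar X(k))$. In both cases $\mathbb{P}(\eta_i(k)=1\mid\bar X(k))=\psi_i(\bar X(k))$. It is known from earlier work that for $\lambda<1/(2d+1)$ this finite system is stable (positive recurrent), so the stationary distribution exists and is unique; by symmetry all queues have the same stationary marginal distribution. *)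

(* Defs.v *)
From HB Require Import structures.
From mathcomp Require Import all_boot all_order all_algebra.
From mathcomp Require Import all_classical all_reals all_analysis.

Set Implicit Arguments.
Unset Strict Implicit.
Unset Printing Implicit Defensive.

Import Order.TTheory GRing.Theory Num.Theory.
Import numFieldNormedType.Exports.

Local Open Scope classical_set_scope.
Local Open Scope ring_scope.

(* Coordinates live in Z/2n; 'Z_(2 * n) is the ring of integers modulo 2n only
   for n >= 1.  Row vectors provide the addition on the torus. *)
Notation torus d n := ('rV['Z_(2 * n)]_d).
Notation state d n := {ffun torus d n -> nat}.

Section Torus.
Variables d n : nat.
Implicit Types i j : torus d n.

Definition torus_adj i j : bool :=
  [exists k : 'I_d, (j == i + delta_mx 0 k) || (j == i - delta_mx 0 k)].

Definition nbhd i : {set torus d n} := [set j | (j == i) || torus_adj i j].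

End Torus.

Variant algorithm := D1 | D2.

Section Dynamics.
Variables (R : realType) (d n : nat).
Implicit Types (x : state d n) (i j : torus d n) (u : torus d n -> R).

(* The convention 0 / 0 = 0 is that of the field division. *)
Definition service_rate x i : R := (x i)%:R / (\sum_(j in nbhd i) x j)%:R.

(* lne is the extended logarithm, with lne 0 = -oo. *)
Definition clock x u i : \bar R :=
  (if x i == 0%N then +oo else - lne (u i)%:E * ((x i)%:R^-1)%:E)%E.

Definition served (alg : algorithm) x u i : bool :=
  (0 < x i)%N &&
  match alg with
  | D1 => [forall j in nbhd i :\ i, (clock x u i < clock x u j)%E]
  | D2 => u i < service_rate x i
  end.

(* a i is the number of arrivals at i; r j is the destination of a job that
   completes service at j, None standing for a departure from the system.
   The subtraction of nat is exact here: a served queue is nonempty. *)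
Definition next_state (alg : algorithm) x (a : torus d n -> nat) u
    (r : torus d n -> option (torus d n)) : state d n :=
  [ffun i => (x i + a i
              + \sum_(j in nbhd i :\ i) (r j == Some i) * served alg x u j
              - served alg x u i)%N].

End Dynamics.

(* F s is the sigma-algebra generated by the s-th member of the family; an
   injective J enumerates a finite subfamily. *)
Definition mutually_independent dT (T : measurableType dT) (R : realType)
    (P : probability T R) (I : Type) (F : I -> set (set T)) : Prop :=
  forall (m : nat) (J : 'I_m -> I) (E : 'I_m -> set T),
    injective J -> (forall l, F (J l) (E l)) ->
    P (\bigcap_l E l) = (\prod_(l < m) P (E l))%E.

Variant source (d n : nat) :=
  | Initial
  | Arrival of nat & torus d n
  | Clock of nat & torus d n
  | Routing of nat & torus d n.

Section Model.
Variables (dT : measure_display) (T : measurableType dT) (R : realType).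
Variables (P : probability T R) (d n : nat).
Variable X : nat -> T -> state d n.
Variable xi : nat -> torus d n -> {RV P >-> nat}.
Variable U : nat -> torus d n -> {RV P >-> R}.
Variable route : nat -> torus d n -> T -> option (torus d n).

Definition source_events (s : source d n) : set (set T) :=
  match s with
  | Initial => preimage_set_system setT (X 0%N) discrete_measurable
  | Arrival k i => preimage_set_system setT (xi k i) measurable
  | Clock k i => preimage_set_system setT (U k i) measurable
  | Routing k i => preimage_set_system setT (route k i) discrete_measurable
  end.

Record multihop (alg : algorithm) (q : R) (mu : probability nat R) : Prop := {
  initial_measurable : forall A : set (state d n), measurable (X 0%N @^-1` A);
  route_measurable : forall k i (A : set (option (torus d n))),
    measurable (route k i @^-1` A);
  arrival_law : forall k i (A : set nat), P (xi k i @^-1` A) = mu A;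
  clock_law : forall k i (A : set R), measurable A ->
    P (U k i @^-1` A) = uniform_prob (@ltr01 R) A;
  departure_law : forall k i, P (route k i @^-1` [set None]) = q%:E;
  routing_law : forall k i j, torus_adj i j ->
    P (route k i @^-1` [set Some j]) = ((1 - q) / (2 * d)%:R)%:E;
  sources_independent : mutually_independent P source_events;
  evolution : forall k w,
    X k.+1 w = next_state alg (X k w) (xi k ^~ w) (U k ^~ w) (route k ^~ w)
}.

(* Under [multihop] the process X is a Markov chain, so this says that the law
   of X 0 is an invariant distribution. *)
Definition stationary : Prop := forall k (x : state d n),
  P (X k @^-1` [set x]) = P (X 0%N @^-1` [set x]).

End Model.

(* Main.v *)
(* The Lyapunov function is V(x) = sum_i x_i^2.  Conditionally on X(0) = x its
   drift is at most -2 eps sum_i x_i + h(x), where eps = q (1/(2d+1) - lambda)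
   and h is affine in the service and transfer rates, because
   x_i psi_i = x_i^2 / S_i, with S_i the content of the neighbourhood of i, lies
   above its tangent at x_i / S_i = 1/(2d+1).  Nothing is known a priori about
   the moments of the stationary law, so the drift is integrated for min(V, M),
   whose stationary mean does not change, and M tends to infinity.  This shows
   that sum_i X_i is integrable; stationarity of its mean then gives the flow
   balance that evaluates E h(X).

   The resulting bound on the mean of sum_i X_i is turned into a bound on X_0 by
   translation invariance of the stationary law.  The transition kernel commutes
   with translations, and its invariant law is unique: the minimum of two
   invariant laws is invariant, so their differences to it are invariant too,
   and one of these vanishes at the empty state, which is reachable from
   everywhere since P(xi = 0) > 0.

   For (D1), node i wins its race iff U_j ^ x_i < U_i ^ x_j for all neighbours j.
   Slicing the values of U_i along the grid t ^ (k x_i), k = 0, 1, 2, ..., encloses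
   this event between unions of boxes whose probabilities are geometric series,
   both converging to x_i / S_i as t tends to 1. *)
Require Import Defs.
From HB Require Import structures.
From mathcomp Require Import all_boot all_order all_algebra.
From mathcomp Require Import all_classical all_reals all_analysis.
From mathcomp Require Import measurable_realfun.
From mathcomp Require Import ring lra zify.

Set Implicit Arguments.
Unset Strict Implicit.
Unset Printing Implicit Defensive.

Import Order.TTheory GRing.Theory Num.Theory.
Import numFieldNormedType.Exports.

Local Open Scope classical_set_scope.
Local Open Scope ring_scope.

(** * The torus, one step of the dynamics, and the quadratic drift *)

(** Under (D1) the services at neighbouring nodes are dependent, so neither the mean of the squared
    inflow A at a node nor that of its product with the service e there follows from the service
    rates. The pathwise bound avoids both: A ^ 2 is at most 2 d A, because each of at most 2 d
    neighbours sends at most one job, and - 2 A e is dropped as nonpositive. What remains involves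
    at most one service, one route and one arrival at a time, whose joint law is a product under
    either algorithm. This is why a single estimate covers (D1) and (D2), and where the term 2 d (1
    - q) lambda comes from.

    Conditioning on X(0) = x means integrating over that fiber, with the state frozen to x in the
    service rule, so that a service depends on the clocks alone. Translation invariance needs more,
    namely the law of all the randomness of one slot; it is known on rectangles and reaches events
    about the next state by a pi-lambda argument. *)

Section TorusGeometry.
Variables d n : nat.
Implicit Types i j s : torus d n.

Lemma torus_adj_sym i j : torus_adj i j = torus_adj j i.
Proof.
apply/existsP/existsP => -[k /orP[] /eqP ->]; exists k; apply/orP.
- by right; rewrite addrK.
- by left; rewrite subrK.
- by right; rewrite addrK.
- by left; rewrite subrK.
Qed.

Lemma torus_adjD i j s : torus_adj (i + s) (j + s) = torus_adj i j.
Proof.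
by apply: eq_existsb => k; rewrite ![i + s + _]addrAC !(inj_eq (addIr s)).
Qed.

Lemma nbhd_sym i j : (j \in nbhd i) = (i \in nbhd j).
Proof. by rewrite !inE eq_sym torus_adj_sym. Qed.

Lemma nbhd_refl i : i \in nbhd i.
Proof. by rewrite inE eqxx. Qed.

Lemma nbhdD i j s : (j + s \in nbhd (i + s)) = (j \in nbhd i).
Proof. by rewrite !inE torus_adjD (inj_eq (addIr s)). Qed.

Lemma nbhdD1D i j s : (j + s \in nbhd (i + s) :\ (i + s)) = (j \in nbhd i :\ i).
Proof. by rewrite in_setD1 nbhdD in_setD1 (inj_eq (addIr s)). Qed.

Lemma nbhdD1_sym i j : (j \in nbhd i :\ i) = (i \in nbhd j :\ j).
Proof. by rewrite !in_setD1 nbhd_sym eq_sym. Qed.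

Lemma nbhdD1_adj i j : j \in nbhd i :\ i -> torus_adj i j.
Proof. by rewrite !inE => /andP[/negbTE ->]. Qed.

(** The signed directions index the candidate neighbours; covering by their image bounds the count
    without proving the neighbours distinct. *)
Lemma card_nbhdD1 i : (#|nbhd i :\ i| <= 2 * d)%N.
Proof.
pose f (p : bool * 'I_d) : torus d n :=
  if p.1 then i + delta_mx 0 p.2 else i - delta_mx 0 p.2.
apply: (@leq_trans #|f @: [set: bool * 'I_d]%SET|).
  apply/subset_leq_card/fintype.subsetP => j /nbhdD1_adj /existsP[k /orP[] /eqP ->].
    by apply/imsetP; exists (true, k); rewrite ?in_setT.
  by apply/imsetP; exists (false, k); rewrite ?in_setT.
by apply: leq_trans (leq_imset_card _ _) _; rewrite cardsT card_prod card_bool card_ord.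
Qed.

Lemma card_nbhd i : (#|nbhd i| <= 2 * d + 1)%N.
Proof. by rewrite (cardsD1 i) nbhd_refl addnC leq_add2r card_nbhdD1. Qed.

Lemma exchange_nbhd (S : nmodType) (F : torus d n -> torus d n -> S) :
  \sum_i \sum_(j in nbhd i :\ i) F i j = \sum_j \sum_(i in nbhd j :\ j) F i j.
Proof.
rewrite (exchange_big_dep predT) //=; apply: eq_bigr => j _.
by apply: eq_bigl => i; rewrite nbhdD1_sym.
Qed.

Lemma exchange_nbhd1 (S : nmodType) (F : torus d n -> torus d n -> S) :
  \sum_i \sum_(j in nbhd i) F i j = \sum_j \sum_(i in nbhd j) F i j.
Proof.
rewrite (exchange_big_dep predT) //=; apply: eq_bigr => j _.
by apply: eq_bigl => i; rewrite nbhd_sym.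
Qed.

End TorusGeometry.

(** * Translations of the torus commute with the dynamics *)

Section Shift.
Variables (R : realType) (d n : nat).
Implicit Types (x : state d n) (i j s : torus d n) (u : torus d n -> R).

Definition shift_state s x : state d n := [ffun i => x (i + s)].

Lemma reindex_nbhd (S : nmodType) s i (F : torus d n -> S) :
  \sum_(j in nbhd (i + s)) F j = \sum_(j in nbhd i) F (j + s).
Proof.
rewrite (reindex (+%R^~ s)) /=; last first.
  by apply: onW_bij; exists (+%R^~ (- s)) => j; rewrite ?addrK ?subrK.
by apply: eq_bigl => j; rewrite nbhdD.
Qed.

Lemma reindex_nbhdD1 (S : nmodType) s i (F : torus d n -> S) :
  \sum_(j in nbhd (i + s) :\ (i + s)) F j = \sum_(j in nbhd i :\ i) F (j + s).
Proof.
rewrite (reindex (+%R^~ s)) /=; last first.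
  by apply: onW_bij; exists (+%R^~ (- s)) => j; rewrite ?addrK ?subrK.
by apply: eq_bigl => j; rewrite nbhdD1D.
Qed.

Lemma served_shift alg s x u i :
  served alg (shift_state s x) (fun j => u (j + s)) i = served alg x u (i + s).
Proof.
rewrite /served ffunE; congr (_ && _); case: alg; last first.
  rewrite /service_rate ffunE; congr (_ < _ / _%:R).
  by rewrite reindex_nbhd; apply: eq_bigr => j _; rewrite ffunE.
have cE j : clock (shift_state s x) (fun j => u (j + s)) j = clock x u (j + s).
  by rewrite /clock ffunE.
apply/forall_inP/forall_inP => h j.
  move=> hj; have := h (j - s); rewrite !cE subrK; apply.
  by rewrite -(nbhdD1D _ _ s) subrK.
by move=> hj; rewrite !cE h// nbhdD1D.
Qed.

(** A route takes nodes as values, so translating it means reindexing its argument and also moving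
    its destination back by [s]. *)
Lemma next_state_shift alg s x (a : torus d n -> nat) u r :
  next_state alg (shift_state s x) (fun j => a (j + s)) (fun j => u (j + s))
    (fun j => omap (fun i => i - s) (r (j + s)))
  = shift_state s (next_state alg x a u r).
Proof.
apply/ffunP => i; rewrite !ffunE !served_shift reindex_nbhdD1.
congr (_ + _ + _ - _)%N; apply: eq_bigr => j _; rewrite served_shift.
congr (nat_of_bool _ * _)%N; case: (r (j + s)) => //= k.
by rewrite !(inj_eq Some_inj) subr_eq.
Qed.

End Shift.

Section Pathwise.
Variables (R : realType) (d n : nat).
Implicit Types (x : state d n) (i j : torus d n) (u : torus d n -> R).

Definition routed_in alg x u (r : torus d n -> option (torus d n)) i : nat :=
  \sum_(j in nbhd i :\ i) (r j == Some i) * served alg x u j.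

(** The additive form removes the truncated subtraction, which is exact because a serving node has
    [0 < x i]. *)
Lemma next_stateE alg x a u r i :
  (next_state alg x a u r i + served alg x u i = x i + a i + routed_in alg x u r i)%N.
Proof.
rewrite /next_state ffunE /routed_in subnK//.
have [/andP[x0 _]|] := boolP (served alg x u i); last by [].
by rewrite -addnA (leq_trans x0)// leq_addr.
Qed.

Lemma routed_in_le alg x u r i : (routed_in alg x u r i <= 2 * d)%N.
Proof.
apply: leq_trans (card_nbhdD1 i); rewrite -sum1_card; apply: leq_sum => j _.
by case: (_ == _) (served _ _ _ _) => -[].
Qed.

(* The negative terms of the expansion of X_i(1)^2 are moved to the left, so
   that every term is nonnegative; the product of the service at i and the
   internal arrivals at i is dropped. *)
Lemma next_state_sqr alg x a u r i (y := next_state alg x a u r i)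
    (e := nat_of_bool (served alg x u i)) (A := routed_in alg x u r i) :
  (y ^ 2 + 2 * x i * e + 2 * a i * e <=
   x i ^ 2 + 2 * x i * a i + 2 * x i * A + a i ^ 2 + 2 * d * A + e + 2 * a i * A)%N.
Proof.
have := next_stateE alg x a u r i; have := routed_in_le alg x u r i.
rewrite -/y -/e -/A => A2 yE; have e1 : (e * e = e)%N by rewrite /e; case: served.
have AA : (A * A <= 2 * d * A)%N by rewrite leq_mul2r A2 orbT.
move: y yE e1 AA => y yE e1 AA; move: e e1 yE => e e1 yE.
have e01 : (e = 0 \/ e = 1)%N by nia.
nia.
Qed.

End Pathwise.

(** * Quadratic drift in terms of the service rates *)

Section Drift.
Variables (R : realType) (d n : nat) (q : R).
Hypotheses (d_gt0 : (0 < d)%N) (q01 : 0 < q < 1).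
Implicit Types (x : state d n) (i j : torus d n).

Lemma service_rate_ge0 x i : 0 <= service_rate R x i.
Proof. by rewrite /service_rate divr_ge0. Qed.

Lemma service_rate_le1 x i : service_rate R x i <= 1.
Proof.
rewrite /service_rate; have xS : (x i <= \sum_(j in nbhd i) x j)%N.
  by rewrite (bigD1 i) ?nbhd_refl//= leq_addr.
case: (ltngtP 0 (\sum_(j in nbhd i) x j)%N) => // [S0|<-]; last by rewrite invr0 mulr0.
by rewrite ler_pdivrMr ?ltr0n// mul1r ler_nat.
Qed.

(** Conditional mean of the number of jobs routed to [i] in one slot, given the state [x]. *)
Definition transfer_rate x i : R :=
  (1 - q) / (2 * d)%:R * \sum_(j in nbhd i :\ i) service_rate R x j.

Lemma transfer_coef_ge0 : 0 <= (1 - q) / (2 * d)%:R.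
Proof. by rewrite divr_ge0// subr_ge0; case/andP: q01 => _ /ltW. Qed.

Lemma transfer_rate_ge0 x i : 0 <= transfer_rate x i.
Proof.
by rewrite mulr_ge0 ?transfer_coef_ge0// sumr_ge0// => j _; exact: service_rate_ge0.
Qed.

(** After exchanging the sums, node [j] passes a fraction (1 - q) / (2 d) of its rate to each of at
    most 2 d neighbours. *)
Lemma sum_transfer_rate x :
  \sum_i transfer_rate x i <= (1 - q) * \sum_i service_rate R x i.
Proof.
rewrite -big_distrr/= exchange_nbhd !big_distrr/=; apply: ler_sum => i _.
rewrite sumr_const -[_ *+ #|_|]mulr_natr [leLHS](_ : _ = (1 - q) * service_rate R x i *
  (#|nbhd i :\ i|%:R / (2 * d)%:R)); last by ring.
rewrite ler_piMr//.
  by rewrite mulr_ge0 ?service_rate_ge0// subr_ge0; case/andP: q01 => _ /ltW.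
by rewrite ler_pdivrMr ?mul1r ?ler_nat ?card_nbhdD1// ltr0n muln_gt0.
Qed.

(* Tangent line of [x ^ 2 / S] at [x / S = 1 / (2 * d + 1)]. *)
Lemma service_rate_tangent x i (a := (2 * d + 1)%:R^-1 : R) :
  2 * a * (x i)%:R - a ^+ 2 * (\sum_(j in nbhd i) x j)%:R
  <= (x i)%:R * service_rate R x i.
Proof.
rewrite /service_rate; have xS : (x i <= \sum_(j in nbhd i) x j)%N.
  by rewrite (bigD1 i) ?nbhd_refl//= leq_addr.
move: (\sum_(j in nbhd i) x j)%N xS => S xS.
case: (posnP S) => [S0|S0].
  by move: xS; rewrite S0 leqn0 => /eqP ->; rewrite !(mulr0, mul0r) subr0.
have SR : 0 < S%:R :> R by rewrite ltr0n.
rewrite -subr_ge0.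
have -> : (x i)%:R * ((x i)%:R / S%:R) - (2 * a * (x i)%:R - a ^+ 2 * S%:R)
  = ((x i)%:R - a * S%:R) ^+ 2 / S%:R :> R by field; rewrite lt0r_neq0.
by rewrite divr_ge0 ?sqr_ge0// ltW.
Qed.

(** In the sum of the tangent bounds each [x j] is counted in at most 2 d + 1 neighbourhoods, which
    leaves 2 a - a ^ 2 (2 d + 1) = a. *)
Lemma sum_service_rate x :
  (2 * d + 1)%:R^-1 * \sum_i (x i)%:R <= \sum_i (x i)%:R * service_rate R x i.
Proof.
set a := (2 * d + 1)%:R^-1.
have a0 : 0 < a by rewrite invr_gt0 ltr0n addn1.
apply: le_trans (ler_sum _ (fun i _ => service_rate_tangent x i)).
rewrite sumrB -!big_distrr/= -/a.
have SW : \sum_i (\sum_(j in nbhd i) x j)%:R <= (2 * d + 1)%:R * \sum_i (x i)%:R :> R.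
  rewrite -natr_sum exchange_nbhd1 -natr_sum -natrM ler_nat big_distrr/=.
  by apply: leq_sum => i _; rewrite sum_nat_const leq_mul2r card_nbhd orbT.
have : a ^+ 2 * \sum_i (\sum_(j in nbhd i) x j)%:R <= a * \sum_i (x i)%:R.
  apply: le_trans (ler_wpM2l (sqr_ge0 a) SW) _; rewrite expr2 -mulrA [a * (_%:R * _)]mulrA.
  by rewrite (_ : a * _%:R = 1) ?mul1r// mulVf// pnatr_eq0 addn1.
lra.
Qed.

Lemma drift_le x (l : R) :
  \sum_i (x i)%:R * (l * q + transfer_rate x i - service_rate R x i)
  <= - (q * ((2 * d + 1)%:R^-1 - l)) * \sum_i (x i)%:R.
Proof.
set k := (1 - q) / (2 * d)%:R; set a := (2 * d + 1)%:R^-1.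
set W := \sum_i (x i)%:R; set Y := \sum_i (x i)%:R * service_rate R x i.
have YE : a * W <= Y by exact: sum_service_rate.
(* From the side of the sending node [j], its rate times the content S_j - x_j of its neighbours is
   x_j (S_j - x_j) / S_j, that is x_j minus x_j times its rate. When S_j = 0 both sides vanish, as
   x_j = 0. *)
have transfer : \sum_i (x i)%:R * transfer_rate x i = k * (W - Y).
  rewrite /transfer_rate -/k; under eq_bigr do rewrite mulrCA big_distrr/=.
  rewrite -big_distrr/= exchange_nbhd -sumrB; congr (k * _); apply: eq_bigr => j _.
  rewrite -big_distrl/= {2}/service_rate mulrC /service_rate.
  have SE : (\sum_(i in nbhd j) x i)%:R = (x j)%:R + \sum_(i in nbhd j :\ j) (x i)%:R :> R.
    by rewrite (big_setD1 j) ?nbhd_refl//= natrD natr_sum.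
  have -> : \sum_(i in nbhd j :\ j) (x i)%:R = (\sum_(i in nbhd j) x i)%:R - (x j)%:R :> R.
    by rewrite SE addrC addKr.
  have [S0|S0] := eqVneq (\sum_(i in nbhd j) x i)%N 0%N; last first.
    by field; rewrite pnatr_eq0.
  have xj0 : x j = 0%N by move/eqP: S0; rewrite (big_setD1 j) ?nbhd_refl//= addn_eq0 => /andP[/eqP].
  by rewrite xj0 !mul0r subr0.
under eq_bigr do rewrite mulrBr mulrDr.
rewrite sumrB big_split/= transfer -big_distrl/= -/W -/Y.
have k0 : 0 <= k by exact: transfer_coef_ge0.
(* Since 1 - a = 2 d a. The coefficient l q + k - (1 + k) a of [W] thereby collapses to - q (a -
   l). *)
have kE : k * (1 - a) = a * (1 - q).
  rewrite /k /a natrD natrM; field; rewrite pnatr_eq0 -lt0n d_gt0 /=.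
  by rewrite -[X in _ + X](mulr1n) -natrM -natrD pnatr_eq0 addn1.
have : (1 + k) * (a * W) <= (1 + k) * Y by rewrite ler_wpM2l//; lra.
have -> : (1 + k) * (a * W) = a * W + k * W - (k * (1 - a)) * W by ring.
rewrite kE; lra.
Qed.

End Drift.

(** * Discrete random variables and independence *)

Section DiscreteVariables.
Variables (dT : measure_display) (T : measurableType dT).

(** Measurability for the discrete sigma-algebra, phrased so that states, finite functions and
    options need no measurable structure of their own. *)
Definition discrete_mfun (K : Type) (f : T -> K) :=
  forall A : set K, measurable (f @^-1` A).

Lemma discrete_mfunP (K : countType) (f : T -> K) :
  (forall k, measurable (f @^-1` [set k])) -> discrete_mfun f.
Proof.
move=> mf A; have -> : f @^-1` A = \bigcup_k (if k \in A then f @^-1` [set k] else set0).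
  apply/seteqP; split=> [w fA|w [k _]]; first by exists (f w) => //; rewrite mem_set.
  by case: ifPn => //; rewrite inE => kA /= ->.
apply: countable_bigcupT_measurable => [|k]; first exact: countableP.
by case: ifP => _; [exact: mf|exact: measurable0].
Qed.

Lemma discrete_mfun_comp (K L : Type) (f : T -> K) (h : K -> L) :
  discrete_mfun f -> discrete_mfun (h \o f).
Proof. by move=> mf A; rewrite comp_preimage. Qed.

Lemma discrete_mfun_pair (K L : countType) (f : T -> K) (g : T -> L) :
  discrete_mfun f -> discrete_mfun g -> discrete_mfun (fun w => (f w, g w)).
Proof.
move=> mf mg; apply: discrete_mfunP => -[k l].
have -> : (fun w => (f w, g w)) @^-1` [set (k, l)] = f @^-1` [set k] `&` g @^-1` [set l].
  by apply/seteqP; split=> w /= => [[-> ->]|[-> ->]].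
by apply: measurableI; [exact: mf|exact: mg].
Qed.

Lemma discrete_mfun_ffun (I : finType) (K : countType) (F : T -> I -> K) :
  (forall i, discrete_mfun (F ^~ i)) -> discrete_mfun (fun w => [ffun i => F w i]).
Proof.
move=> mF; apply: discrete_mfunP => k.
have -> : (fun w => [ffun i => F w i]) @^-1` [set k]
    = \bigcap_(i in [set: I]) ((F ^~ i) @^-1` [set k i]).
  apply/seteqP; split=> w /=; first by move=> <- i _ /=; rewrite ffunE.
  by move=> wk; apply/ffunP => i; rewrite ffunE; exact: wk.
by apply: fin_bigcap_measurable => // i _; exact: mF.
Qed.

Lemma discrete_mfunW d' (T' : measurableType d') (K : Type) (f : T -> K) (h : K -> T') D :
  discrete_mfun f -> measurable_fun D (h \o f).
Proof. by move=> mf mD A mA; apply: measurableI => //; exact: (mf (h @^-1` A)). Qed.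

End DiscreteVariables.

(** * Integration over the fibers of a discrete variable *)

Section Fibers.
Variables (dT : measure_display) (T : measurableType dT) (R : realType).
Variables (P : {measure set T -> \bar R}) (K : countType) (f : T -> K).
Hypothesis mf : discrete_mfun f.
Local Open Scope ereal_scope.

(** This stands in for conditional expectation: a relation checked on every event [f = k] is summed
    over [k]. *)
Lemma ge0_integral_fibers (D : set K) (g : T -> \bar R) :
  measurable_fun setT g -> (forall w, 0 <= g w) ->
  \int[P]_(w in f @^-1` D) g w = \esum_(k in D) \int[P]_(w in f @^-1` [set k]) g w.
Proof.
move=> mg g0.
(* Numbering the values by [pickle] gives a sequence of disjoint sets; [F m] is a fiber when [m]
   codes an element of [D], and empty otherwise. *)
pose F m := f @^-1` [set k | D k /\ pickle k = m].
have DF : f @^-1` D = \bigcup_m F m.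
  by apply/seteqP; split=> [w Dw|w [m _ []]//]; exists (pickle (f w)).
rewrite DF ge0_integral_bigcup//; last 3 first.
- by move=> m; exact: mf.
- exact: measurable_funTS.
- by move=> i j _ _ [w [[_ <-] [_ <-]]].
rewrite nneseries_esumT => [|m]; last exact: integral_ge0.
have -> : \esum_(m in [set: nat]) \int[P]_(w in F m) g w
    = \esum_(m in [set pickle k | k in D]) \int[P]_(w in F m) g w.
  rewrite [RHS]esum_mkcond; apply: eq_esum => m _; case: ifPn => //.
  rewrite notin_setE => mD; rewrite (_ : F m = set0) ?integral_set0//.
  by rewrite -subset0 => w [Dw wm]; apply: mD; exists (f w).
rewrite esum_image => [|k l _ _]; last exact: (pcan_inj pickleK).
apply: eq_esum => k Dk; congr integral; apply/seteqP; split=> w /=.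
  by case=> _ /(pcan_inj pickleK).
by rewrite /F/= => ->.
Qed.

Lemma le_integral_fibers (D : set K) (g1 g2 : T -> \bar R) :
  measurable_fun setT g1 -> measurable_fun setT g2 ->
  (forall w, 0 <= g1 w) -> (forall w, 0 <= g2 w) ->
  (forall k, \int[P]_(w in f @^-1` [set k]) g1 w <= \int[P]_(w in f @^-1` [set k]) g2 w) ->
  \int[P]_(w in f @^-1` D) g1 w <= \int[P]_(w in f @^-1` D) g2 w.
Proof.
by move=> mg1 mg2 g10 g20 le12; rewrite !ge0_integral_fibers//; exact: le_esum.
Qed.

Lemma eq_integral_fibers (D : set K) (g1 g2 : T -> \bar R) :
  measurable_fun setT g1 -> measurable_fun setT g2 ->
  (forall w, 0 <= g1 w) -> (forall w, 0 <= g2 w) ->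
  (forall k, \int[P]_(w in f @^-1` [set k]) g1 w = \int[P]_(w in f @^-1` [set k]) g2 w) ->
  \int[P]_(w in f @^-1` D) g1 w = \int[P]_(w in f @^-1` D) g2 w.
Proof.
by move=> mg1 mg2 g10 g20 e12; rewrite !ge0_integral_fibers//; exact: eq_esum.
Qed.

Lemma integral_discrete (D : set K) (h : K -> \bar R) : (forall k, 0 <= h k) ->
  \int[P]_(w in f @^-1` D) h (f w) = \esum_(k in D) h k * P (f @^-1` [set k]).
Proof.
move=> h0; rewrite ge0_integral_fibers//; last exact: (@discrete_mfunW _ _ _ _ _ f h).
apply: eq_esum => k _; rewrite -(integral_cst P (mf [set k])).
by apply: eq_integral => w; rewrite inE/= => ->.
Qed.

Lemma measure_fibers (D : set K) :
  P (f @^-1` D) = \esum_(k in D) P (f @^-1` [set k]).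
Proof.
rewrite -[LHS]mul1e -(integral_cst P (mf D)).
rewrite (integral_discrete D (h := cst 1))//.
by apply: eq_esum => k _; rewrite mul1e.
Qed.

Lemma ge0_integral_setI_fibers (C : set T) (g : T -> \bar R) : measurable C ->
  measurable_fun setT g -> (forall w, 0 <= g w) ->
  \int[P]_(w in C) g w = \esum_(k in setT) \int[P]_(w in C `&` f @^-1` [set k]) g w.
Proof.
move=> mC mg g0; rewrite -[C in LHS]setTI integral_mkcondr.
rewrite -[X in \int[P]_(w in X) _](preimage_setT f) ge0_integral_fibers; last 2 first.
- by apply/(measurable_restrictT _ mC); exact: measurable_funTS.
- by move=> w; rewrite patchE; case: ifP.
by apply: eq_esum => k _; rewrite setIC integral_mkcondr.
Qed.

Lemma measure_setI_fibers (C : set T) : measurable C ->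
  P C = \esum_(k in setT) P (C `&` f @^-1` [set k]).
Proof.
move=> mC; rewrite -[LHS]mul1e -(integral_cst P mC) ge0_integral_setI_fibers//.
by apply: eq_esum => k _; rewrite integral_cst ?mul1e//; apply: measurableI => //; exact: mf.
Qed.

End Fibers.

Section EqualLaw.
Variables (dT : measure_display) (T : measurableType dT) (R : realType).
Variables (P : {measure set T -> \bar R}) (K : countType) (f g : T -> K).
Hypotheses (mf : discrete_mfun f) (mg : discrete_mfun g).
Hypothesis fg : forall k, P (f @^-1` [set k]) = P (g @^-1` [set k]).
Local Open Scope ereal_scope.

Lemma eq_law_integral (D : set K) (h : K -> \bar R) : (forall k, 0 <= h k) ->
  \int[P]_(w in f @^-1` D) h (f w) = \int[P]_(w in g @^-1` D) h (g w).
Proof.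
by move=> h0; rewrite !integral_discrete//; apply: eq_esum => k _; rewrite fg.
Qed.

Lemma eq_law_measure (D : set K) : P (f @^-1` D) = P (g @^-1` D).
Proof. by rewrite !measure_fibers//; apply: eq_esum => k _; exact: fg. Qed.

End EqualLaw.

Section IndependentIntegral.
Variables (dT : measure_display) (T : measurableType dT) (R : realType).
Variables (P : probability T R) (mu : probability nat R) (C : set T) (X : {RV P >-> nat}).
Hypothesis mC : measurable C.
Hypothesis indep : forall A : set nat, P (C `&` X @^-1` A) = (P C * mu A)%E.
Local Open Scope ereal_scope.

(** On [C] intersected with X = m the integrand is the constant [h m], so independence on events is
    enough. In the applications [C] fixes the state and possibly a service and a route, and [X] is
    an arrival. *)
Lemma indep_integral (h : nat -> \bar R) : (forall m, 0 <= h m) ->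
  \int[P]_(w in C) h (X w) = P C * \int[mu]_m h m.
Proof.
move=> h0; have mX : discrete_mfun X.
  by move=> A; rewrite -[_ @^-1` _]setTI; exact: measurable_funP.
have mid : discrete_mfun (@idfun nat) by [].
rewrite (ge0_integral_setI_fibers P mX)//; last exact: (@discrete_mfunW _ _ _ _ _ X h).
have mh : measurable_fun setT h by move=> _ A _; exact: (mid (setT `&` h @^-1` A)).
rewrite -ge0_integralZl//.
rewrite -[X in \int[mu]_(m in X) _](preimage_setT idfun).
rewrite (integral_discrete mu mid setT (h := fun m => P C * h m)); last first.
  by move=> m; rewrite mule_ge0.
apply: eq_esum => m _; rewrite muleAC -indep [in RHS]muleC -integral_cst; last first.
  by apply: measurableI => //; exact: mX.
by apply: eq_integral => w; rewrite inE => -[_ /= ->].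
Qed.

End IndependentIntegral.

(** * Pi-lambda extension of a product formula *)

Section Dynkin.
Variables (dT : measure_display) (T : measurableType dT) (R : realType).
Variables (P : probability T R) (Omega : Type) (G : set (set Omega)).
Hypothesis setIG : setI_closed G.
Variables (f g : T -> Omega) (C : set T).
Hypotheses (mC : measurable C).
Hypotheses (mf : forall D, G D -> measurable (f @^-1` D)).
Hypotheses (mg : forall D, G D -> measurable (g @^-1` D)).
Hypothesis fg : forall D, G D -> P (C `&` f @^-1` D) = (P C * P (g @^-1` D))%E.

(** The sets satisfying the three conclusions form a Dynkin system. Measurability is carried along
    because complements and disjoint unions need it. Having [g] on the right instead of [f] lets one
    identity express independence from [C] and equality in law. *)
Lemma dynkin_indep (D : set Omega) : <<s G >> D ->
  [/\ measurable (f @^-1` D), measurable (g @^-1` D) &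
      P (C `&` f @^-1` D) = (P C * P (g @^-1` D))%E].
Proof.
rewrite -setI_closed_g_dynkin_g_sigma_algebra//.
move: D; apply: smallest_sub => [|D GD]; last by split; [exact: mf|exact: mg|exact: fg].
split.
- by split; rewrite ?preimage_setT// setIT probability_setT mule1.
- move=> D [mfD mgD fgD]; split; [exact: measurableC|exact: measurableC|].
  have -> : C `&` f @^-1` (~` D) = C `\` f @^-1` D by rewrite setDE.
  rewrite measureD//; last by rewrite (le_lt_trans (probability_le1 P mC)) ?ltry.
  transitivity (P C - P C * P (g @^-1` D))%E; first by congr (_ - _)%E.
  rewrite (_ : g @^-1` (~` D) = ~` (g @^-1` D))// probability_setC//.
  by rewrite muleBr ?mule1 ?fin_num_measure// fin_num_adde_defr.
- move=> F tF FG; rewrite !preimage_bigcup.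
  have mfF i : measurable (f @^-1` F i) by case: (FG i).
  have mgF i : measurable (g @^-1` F i) by case: (FG i).
  have tg : trivIset setT (fun i => g @^-1` F i).
    by move=> i j _ _ [w [Fi Fj]]; apply: (tF i j) => //; exists (g w).
  have tf : trivIset setT (fun i => f @^-1` F i).
    by move=> i j _ _ [w [Fi Fj]]; apply: (tF i j) => //; exists (f w).
  split; try exact: bigcupT_measurable.
  rewrite setI_bigcupr (measure_semi_bigcup P mgF tg); last exact: bigcupT_measurable.
  have mCF i : measurable (C `&` f @^-1` F i) by exact: measurableI.
  rewrite (measure_semi_bigcup P mCF (@trivIset_setIl _ _ _ _ (fun=> C) tf)); last first.
    exact: bigcupT_measurable.
  rewrite -(fineK (fin_num_measure P _ mC)) -nneseriesZl//.
  by apply: eq_eseriesr => i _; rewrite fineK ?fin_num_measure//; case: (FG i).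
Qed.

End Dynkin.

(** * Competing clocks *)

Section GeometricBounds.
Variable R : realType.
Implicit Types t a b e : R.

Lemma le_geometric a b e t : 0 < t < 1 -> 0 <= e ->
  (forall K, a <= b + e * t ^+ K) -> a <= b.
Proof.
move=> /andP[t0 t1] e0 h; apply/ler_addgt0Pl => r r0.
(* Dividing by [e + 1] rather than [e] covers [e = 0]. *)
have e1 : 0 < e + 1 by rewrite ltr_wpDl.
have : (t ^+ K @[K --> \oo] --> 0) by apply: cvg_expr; rewrite gtr0_norm.
move=> /cvgr0_norm_lt /(_ (r / (e + 1))) []; first by rewrite divr_gt0.
move=> N _ /(_ N (leqnn N)) /=; rewrite ger0_norm ?exprn_ge0 ?(ltW t0)// => tN.
have := h N; move: tN; rewrite ltr_pdivlMr// mulrC => tN hN.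
apply: le_trans hN _; rewrite addrC lerD2r ltW//; apply: le_lt_trans tN.
by rewrite mulrDl mul1r lerDl exprn_ge0// ltW.
Qed.

Lemma bernoulli t m : 0 <= t <= 1 -> 1 - m%:R * (1 - t) <= t ^+ m.
Proof.
move=> /andP[t0 t1]; elim: m => [|m IH]; first by rewrite mul0r subr0 expr0.
have tm1 : t ^+ m <= 1 by rewrite exprn_ile1.
rewrite exprS -natr1; have : (1 - t ^+ m) * (1 - t) >= 0 by rewrite mulr_ge0// subr_ge0.
lra.
Qed.

(** 1 - t ^ m is 1 - t times the sum of the [m] powers t ^ k with k < m, each at least t ^ m. *)
Lemma subXn_ge t m : 0 <= t <= 1 -> m%:R * (1 - t) * t ^+ m <= 1 - t ^+ m.
Proof.
move=> /andP[t0 t1]; elim: m => [|m IH]; first by rewrite mul0r mul0r expr0 subrr.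
have tm0 : 0 <= t ^+ m by rewrite exprn_ge0.
rewrite exprS -natr1.
have : m%:R * (1 - t) * (t * t ^+ m) <= m%:R * (1 - t) * t ^+ m.
  by apply: ler_wpM2l; rewrite ?mulr_ge0 ?subr_ge0// ler_piMl.
have : (1 - t) * (t * t ^+ m) <= (1 - t) * t ^+ m.
  by apply: ler_wpM2l; rewrite ?subr_ge0// ler_piMl.
lra.
Qed.

(** The limit t to 1, taken along t = 1 - 2 ^ (-K): by Bernoulli's inequality the loss is at most a
    m 2 ^ (-K). *)
Lemma le_bernoulli a b m : 0 <= a ->
  (forall t, 0 < t < 1 -> a * t ^+ m <= b) -> a <= b.
Proof.
move=> a0 h; apply: (@le_geometric _ _ (a * m%:R) 2^-1); first by lra.
  by rewrite mulr_ge0.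
(* [K = 0] would mean t = 0, outside the range of [h]. There the bound is a <= b + a m: it is [h]
   itself when m = 0, and follows from b >= 0 otherwise. *)
move=> [|K].
  have := h 2^-1; rewrite expr0 mulr1 => hh.
  have b0 : 0 <= b by apply: le_trans (hh _); rewrite ?mulr_ge0 ?exprn_ge0//; lra.
  case: m h hh => [|m] h hh; first by have := hh; rewrite expr0 mulr1 mulr0 addr0; apply; lra.
  by rewrite -[leLHS]add0r lerD// -natr1 mulrDr mulr1 lerDr mulr_ge0.
set s := 2^-1 ^+ K.+1; have s0 : 0 < s by rewrite exprn_gt0; lra.
have s1 : s < 1 by rewrite exprn_ilt1//; lra.
have := h (1 - s); have := @bernoulli (1 - s) m.
rewrite opprB addrCA subrr addr0 => B H.
have {}B : 1 - m%:R * s <= (1 - s) ^+ m by apply: B; lra.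
have {}H : a * (1 - s) ^+ m <= b by apply: H; lra.
have := ler_wpM2l a0 B; lra.
Qed.

(** Letting [K] grow sums the series to c (1 - t ^ p) t ^ (S - p) / (1 - t ^ S). After division by 1
    - t, the two bounds on 1 - t ^ p and 1 - t ^ S give c p t ^ S <= y S, and t tends to 1. *)
Lemma geometric_le (c y : R) (p S : nat) : (0 < p <= S)%N -> 0 <= c ->
  (forall t K, 0 < t < 1 ->
     \sum_(k < K) c * (t ^+ (k * S) * (1 - t ^+ p) * t ^+ (S - p)) <= y) ->
  c * p%:R <= y * S%:R.
Proof.
move=> /andP[p0 pS] c0 h; have S0 := leq_trans p0 pS.
apply: (@le_bernoulli _ _ S); first by rewrite mulr_ge0.
move=> t t01; case/andP: (t01) => t0 t1.
have tS1 : t ^+ S < 1 by rewrite exprn_ilt1 ?(ltW t0)// -lt0n.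
have tS0 : 0 < t ^+ S by rewrite exprn_gt0.
have tp1 : t ^+ p <= 1 by rewrite exprn_ile1 ?(ltW t0) ?(ltW t1).
pose e := c * (1 - t ^+ p) * t ^+ (S - p).
have e0 : 0 <= e by rewrite !mulr_ge0 ?subr_ge0 ?exprn_ge0 ?(ltW t0).
have y1 : e <= y * (1 - t ^+ S).
  apply: (@le_geometric _ _ e (t ^+ S)); rewrite ?tS0// => K.
  have := h t K t01; under eq_bigr do rewrite [(_ * S)%N]mulnC exprM.
  rewrite (_ : \sum_(k < K) _ = e * \sum_(k < K) (t ^+ S) ^+ k); last first.
    by rewrite big_distrr/=; apply: eq_bigr => k _; rewrite /e; ring.
  have tS1' : 0 <= 1 - t ^+ S by rewrite subr_ge0 ltW.
  move/(ler_wpM2r tS1').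
  have -> : e * (\sum_(k < K) (t ^+ S) ^+ k) * (1 - t ^+ S) = e * (1 - (t ^+ S) ^+ K).
    by rewrite -[1 - _ ^+ K]opprB subrX1; ring.
  lra.
have := @subXn_ge t p; have := @bernoulli t S; rewrite ltW//= ltW//= => /(_ isT) B /(_ isT) Bp.
have d0 : 0 < 1 - t by rewrite subr_gt0.
rewrite -(ler_pM2r d0).
have y0 : 0 <= y by have := h t 0%N t01; rewrite big_ord0.
apply: (@le_trans _ _ (y * (1 - t ^+ S))); last first.
  by rewrite -mulrA ler_wpM2l//; lra.
apply: le_trans y1; rewrite /e -{1}(subnKC pS) exprD.
have := ler_wpM2l c0 Bp; move/(ler_wpM2r (exprn_ge0 (S - p) (ltW t0))); lra.
Qed.

(** Mirror image of the preceding bound; the extra term c t ^ (K p) pays for the values below the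
    grid and vanishes as [K] grows. *)
Lemma geometric_ge (c y : R) (p S : nat) : (0 < p)%N -> (0 < S)%N -> 0 <= c -> 0 <= y ->
  (forall t K, 0 < t < 1 ->
     y <= \sum_(k < K) c * (t ^+ (k * S) * (1 - t ^+ p)) + c * t ^+ (K * p)) ->
  y * S%:R <= c * p%:R.
Proof.
move=> p0 S0 c0 y0 h; apply: (@le_bernoulli _ _ S); first by rewrite mulr_ge0.
move=> t t01; case/andP: (t01) => t0 t1.
have tS1 : t ^+ S < 1 by rewrite exprn_ilt1 ?(ltW t0)// -lt0n.
have tp1 : t ^+ p < 1 by rewrite exprn_ilt1 ?(ltW t0)// -lt0n.
have tp0 : 0 < t ^+ p by rewrite exprn_gt0.
have y1 : y * (1 - t ^+ S) <= c * (1 - t ^+ p).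
  apply: (@le_geometric _ _ c (t ^+ p)); rewrite ?tp0// => K.
  have := h t K t01; under eq_bigr do rewrite [(_ * S)%N]mulnC exprM.
  rewrite (_ : \sum_(k < K) _ = c * (1 - t ^+ p) * \sum_(k < K) (t ^+ S) ^+ k); last first.
    by rewrite big_distrr/=; apply: eq_bigr => k _; ring.
  rewrite [(K * p)%N]mulnC exprM.
  have tS1' : 0 <= 1 - t ^+ S by rewrite subr_ge0 ltW.
  move/(ler_wpM2r tS1').
  rewrite mulrDl.
  have -> : c * (1 - t ^+ p) * (\sum_(k < K) (t ^+ S) ^+ k) * (1 - t ^+ S)
    = c * (1 - t ^+ p) * (1 - (t ^+ S) ^+ K).
    by rewrite -[1 - _ ^+ K]opprB subrX1; ring.
  have tSK : 0 <= (t ^+ S) ^+ K by rewrite !exprn_ge0// ltW.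
  have tpK : 0 <= (t ^+ p) ^+ K by rewrite !exprn_ge0// ltW.
  have : 0 <= c * (1 - t ^+ p) * (t ^+ S) ^+ K by rewrite !mulr_ge0// subr_ge0 ltW.
  have : 0 <= c * (t ^+ p) ^+ K * t ^+ S by rewrite !mulr_ge0// exprn_ge0// ltW.
  lra.
have := @subXn_ge t S; have := @bernoulli t p; rewrite ltW//= ltW//= => /(_ isT) B /(_ isT) Bp.
have d0 : 0 < 1 - t by rewrite subr_gt0.
rewrite -(ler_pM2r d0); have := ler_wpM2l y0 Bp.
have : c * (1 - t ^+ p) <= c * (p%:R * (1 - t)) by rewrite ler_wpM2l//; lra.
lra.
Qed.

End GeometricBounds.

Section Uniform.
Variable R : realType.

Lemma uniform_probE (A : set R) : measurable A ->
  uniform_prob (@ltr01 R) A = lebesgue_measure (A `&` `[0, 1]).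
Proof.
move=> mA; rewrite /uniform_prob integral_uniform_pdf.
rewrite (eq_integral (cst 1%E)); last first.
  by move=> r; rewrite inE => -[_ /=]; rewrite in_itv/= /uniform_pdf => ->; rewrite subr0 invr1.
by rewrite integral_cst ?mul1e//; exact: measurableI.
Qed.

Lemma uniform_prob_itv (b1 b2 : bool) (l r : R) : 0 <= l -> l <= r -> r <= 1 ->
  uniform_prob (@ltr01 R) [set` Interval (BSide b1 l) (BSide b2 r)] = (r - l)%:E.
Proof.
move=> l0 lr r1; rewrite uniform_probE; last exact: measurable_itv.
rewrite setIidl; last first.
  move=> s /=; rewrite !in_itv/= => /andP[ls sr]; apply/andP; split.
    by apply: le_trans l0 _; move: ls; case: b1 => //= /ltW.
  by apply: le_trans r1; move: sr; case: b2 => //= /ltW.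
rewrite lebesgue_measure_itv/= lte_fin; have [//|rl] := ltP l r.
have -> : r = l by apply/eqP; rewrite eq_le lr rl.
by rewrite subrr.
Qed.

End Uniform.

(** * Probability that a given clock wins its race *)

Section CompetingClocks.
Variables (dT : measure_display) (T : measurableType dT) (R : realType).
Variables (P : probability T R) (I : finType) (U : I -> {RV P >-> R}) (C : set T).
Hypothesis mC : measurable C.
Hypothesis indepC : forall B : I -> set R, (forall i, measurable (B i)) ->
  P (C `&` \bigcap_i (U i @^-1` B i)) = (P C * \prod_i uniform_prob (@ltr01 R) (B i))%E.

Lemma measurable_box (B : I -> set R) : (forall i, measurable (B i)) ->
  measurable (C `&` \bigcap_i (U i @^-1` B i)).
Proof.
move=> mB; apply: measurableI => //; apply: fin_bigcap_measurable => // i _.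
by rewrite -[_ @^-1` _]setTI; exact: measurable_funP.
Qed.

Variables (i0 : I) (J : {set I}) (a : I -> nat) (E : set T).
Hypotheses (i0J : i0 \notin J) (a0 : (0 < a i0)%N) (mE : measurable E).
(** The inequality between powers is the comparison of - log U / a with the denominators cleared. It
    is required only where all values lie strictly between 0 and 1, an event of full probability. *)
Hypothesis EP : forall w, (forall l, 0 < U l w < 1) ->
  E w <-> forall j, j \in J -> U j w ^+ a i0 < U i0 w ^+ a j.

Let c := fine (P C).
Let cE : P C = c%:E. Proof. by rewrite fineK// fin_num_measure. Qed.
Let c0 : 0 <= c. Proof. exact: fine_ge0. Qed.
Let p := a i0.
Let S := (p + \sum_(j in J) a j)%N.

(** Indices outside the race are confined to ]0, 1[ instead of being left free, so that [EP] applies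
    throughout a box. *)
Definition box (A : set R) (t : R) (e : I -> nat) (l : I) : set R :=
  if l == i0 then A else if l \in J then `]0, t ^+ e l[%classic else `]0, 1[%classic.

Definition boxed A t e : set T := C `&` \bigcap_l (U l @^-1` box A t e l).

Lemma measurable_boxed (A : set R) t e : measurable A -> measurable (boxed A t e).
Proof.
move=> mA; apply: measurable_box => l; rewrite /box.
by case: eqP => // _; case: ifP => _; exact: measurable_itv.
Qed.

Lemma measure_boxed (A : set R) v t e : 0 < t < 1 -> measurable A ->
  uniform_prob (@ltr01 R) A = v%:E ->
  P (boxed A t e) = (c * (v * t ^+ (\sum_(j in J) e j)))%:E.
Proof.
move=> /andP[t0 t1] mA vA; rewrite indepC => [|l]; last first.
  by rewrite /box; case: eqP => // _; case: ifP => _; exact: measurable_itv.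
rewrite (eq_bigr (fun l => (if l == i0 then v else if l \in J then t ^+ e l else 1)%:E)); last first.
  move=> l _; rewrite /box; case: eqP => // _.
  have tl1 : t ^+ e l <= 1 by rewrite exprn_ile1// ltW.
  have tl0 : 0 <= t ^+ e l by rewrite exprn_ge0// ltW.
  by case: ifP => _; rewrite uniform_prob_itv ?subr0.
rewrite prodEFin cE -EFinM (bigD1 i0)//= eqxx; congr (c * (v * _))%:E.
rewrite (eq_bigr (fun l => if l \in J then t ^+ e l else 1)); last by move=> l /negbTE ->.
rewrite -big_mkcondr/= -expr_sum; congr (_ ^+ _); apply: eq_bigl => l.
by case: eqVneq => //= ->; rewrite (negbTE i0J).
Qed.

(** The factor [p] in the exponents makes p-th roots exact: when the value at [i0] lies in cell k,
    U_j < t ^ ((k + 1) a_j) is sufficient for beating j, and U_j < t ^ (k a_j) is necessary. *)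
Definition cell (t : R) k : set R := `[t ^+ (k.+1 * p), t ^+ (k * p)[%classic.

Lemma uniform_cell t k : 0 < t < 1 ->
  uniform_prob (@ltr01 R) (cell t k) = (t ^+ (k * p) * (1 - t ^+ p))%:E.
Proof.
move=> /andP[t0 t1]; rewrite uniform_prob_itv.
- by rewrite mulSn exprD; congr EFin; ring.
- by rewrite exprn_ge0// ltW.
- by rewrite mulSn exprD ler_piMl ?exprn_ge0 ?exprn_ile1// ltW.
- by rewrite exprn_ile1// ltW.
Qed.

Lemma boxed_cell_trivIset t (e : nat -> I -> nat) : 0 < t < 1 ->
  trivIset setT (fun k => boxed (cell t k) t (e k)).
Proof.
move=> /andP[t0 t1] k l _ _ [w [[_ wk] [_ wl]]].
have := wk i0 Logic.I; have := wl i0 Logic.I; rewrite /box eqxx /cell /= !in_itv/=.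
wlog kl : k l {wk wl} / (k < l)%N => [hw|].
  by move=> hl hk; case: (ltngtP k l) => // kl; [exact: hw kl hl hk|exact/esym/(hw _ _ kl hk hl)].
move=> /andP[_ wl'] /andP[wk' _]; have : t ^+ (l * p) <= t ^+ (k.+1 * p).
  by rewrite ler_wiXn2l ?leq_mul2r ?kl ?orbT// ltW.
by move=> tlk; have := lt_le_trans wl' tlk; rewrite ltNge wk'.
Qed.

Lemma boxed_in01 t (A : set R) e w : 0 < t < 1 -> A `<=` `]0, 1[ ->
  boxed A t e w -> forall l, 0 < U l w < 1.
Proof.
move=> /andP[t0 t1] A01 [_ wB] l; have := wB l Logic.I; rewrite /box /=.
case: eqP => [_|_]; first by move/A01; rewrite /= in_itv.
case: ifP => _; rewrite /= in_itv/= => /andP[-> ul]//=.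
by apply: lt_le_trans ul _; rewrite exprn_ile1// ltW.
Qed.

Lemma cell_in01 t k : 0 < t < 1 -> cell t k `<=` `]0, 1[.
Proof.
move=> /andP[t0 t1] r; rewrite /cell/= !in_itv/= => /andP[tr rt]; apply/andP; split.
  by apply: lt_le_trans tr; rewrite exprn_gt0.
by apply: lt_le_trans rt _; rewrite exprn_ile1// ltW.
Qed.

(** The boxes with exponents (k + 1) a_j are disjoint and lie inside the event. As the a_j sum to S
    - p, each has probability c t ^ (k p) (1 - t ^ p) t ^ ((k + 1) (S - p)). *)
Lemma competing_lower t K : 0 < t < 1 ->
  \sum_(k < K) c * (t ^+ (k * S) * (1 - t ^+ p) * t ^+ (S - p)) <= fine (P (C `&` E)).
Proof.
move=> t01; case/andP: (t01) => t0 t1.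
pose L k := boxed (cell t k) t (fun l => k.+1 * a l)%N.
have mL k : measurable (L k) by apply: measurable_boxed; exact: measurable_itv.
have PL k : P (L k) = (c * (t ^+ (k * S) * (1 - t ^+ p) * t ^+ (S - p)))%:E.
  rewrite (measure_boxed _ t01 (measurable_itv _) (uniform_cell k t01)).
  by rewrite -big_distrr/= /S addKn mulnDr exprD mulSn exprD; congr (c * _)%:E; ring.
have mCE : measurable (C `&` E) by exact: measurableI.
rewrite -lee_fin fineK ?fin_num_measure//.
rewrite -sumEFin; under eq_bigr do rewrite -PL.
rewrite -measure_bigsetU//; last exact: boxed_cell_trivIset.
rewrite le_measure ?inE//; first exact: bigsetU_measurable.
move=> w; rewrite -bigcup_mkord => -[k _ Lk].
have w01 := boxed_in01 t01 (cell_in01 t01) Lk.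
case: Lk => Cw wB; split => //; apply/(EP w01) => j jJ.
have := wB j Logic.I; have := wB i0 Logic.I; rewrite /box eqxx jJ /=.
rewrite ifN; last by apply: contraNneq i0J => <-.
rewrite /cell/= !in_itv/= => /andP[wi _] /andP[wj0 wj].
apply: (@lt_le_trans _ _ ((t ^+ (k.+1 * a j)) ^+ p)).
  by rewrite ltrXn2r -?lt0n// ltW.
rewrite -exprM mulnAC exprM lerXn2r ?nnegrE ?exprn_ge0// ltW//.
by have /andP[] := w01 i0.
Qed.

(** The boxes with exponents k a_j cover the event, up to [Z], where the value at [i0] falls below
    the grid, and the null set where some value leaves ]0, 1[. *)
Lemma competing_upper t K : 0 < t < 1 ->
  fine (P (C `&` E)) <= \sum_(k < K) c * (t ^+ (k * S) * (1 - t ^+ p)) + c * t ^+ (K * p).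
Proof.
move=> t01; case/andP: (t01) => t0 t1.
pose L k := boxed (cell t k) t (fun l => k * a l)%N.
have mL k : measurable (L k) by apply: measurable_boxed; exact: measurable_itv.
have PL k : P (L k) = (c * (t ^+ (k * S) * (1 - t ^+ p)))%:E.
  rewrite (measure_boxed _ t01 (measurable_itv _) (uniform_cell k t01)).
  by rewrite -big_distrr/= /S mulnDr exprD; congr (c * _)%:E; ring.
pose Z := boxed `]0, t ^+ (K * p)[ t (fun=> 0)%N.
have tK1 : t ^+ (K * p) <= 1 by rewrite exprn_ile1// ltW.
have PZ : P Z = (c * t ^+ (K * p))%:E.
  rewrite (measure_boxed _ t01 (measurable_itv _) (uniform_prob_itv _ _ _ _ tK1))//.
    by rewrite subr0 big1// expr0 mulr1.
  by rewrite exprn_ge0// ltW.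
pose N := boxed `]0, 1[ t (fun=> 0)%N.
have mN : measurable N by apply: measurable_boxed; exact: measurable_itv.
have PN : P N = P C.
  rewrite (measure_boxed _ t01 (measurable_itv _) (uniform_prob_itv _ _ _ _ _))//.
  by rewrite subr0 big1// expr0 !mulr1.
have mZ : measurable Z by apply: measurable_boxed; exact: measurable_itv.
have mCE : measurable (C `&` E) by exact: measurableI.
have mB : measurable (\big[setU/set0]_(k < K) L k) by exact: bigsetU_measurable.
rewrite -lee_fin fineK ?fin_num_measure//.
have NC : N `<=` C by move=> w [].
have CN0 : P (C `\` N) = 0%E.
  rewrite measureD//; last by rewrite (le_lt_trans (probability_le1 P mC)) ?ltry.
  transitivity (P C - P C)%E; last by rewrite subee// fin_num_measure.
  by congr (_ - _)%E; rewrite (setIidr NC); exact: PN.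
have CEs : C `&` E `<=` (\big[setU/set0]_(k < K) L k `|` Z) `|` (C `\` N).
  move=> w [Cw Ew]; case: (pselect (N w)) => [Nw|]; last by right; split.
  left; have w01 : forall l, 0 < U l w < 1 by exact: (boxed_in01 t01 _ Nw).
  have [wK|wK] := ltP (U i0 w) (t ^+ (K * p)).
    right; split => // l _; have := w01 l; rewrite /box/=.
    case: eqP => [->|_]; first by rewrite /= in_itv/= wK => /andP[->].
    by case: ifP => _; rewrite ?expr0/= in_itv.
  left; rewrite -bigcup_mkord.
  (* The least such [k] is the index of the cell: minimality supplies the upper end, except at
     [k = 0], where that end is 1. *)
  have : exists k, (k < K)%N && (t ^+ (k.+1 * p) <= U i0 w).
    case: K wK {Z PZ mZ tK1 mB} => [|K] wK; last by exists K; rewrite ltnSn.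
    by move: wK; rewrite mul0n expr0 leNgt; have /andP[_ ->] := w01 i0.
  move=> kex; have [k /andP[kK wk] kmin] := ex_minnP kex.
  have wk' : U i0 w < t ^+ (k * p).
    case: k kK wk kmin => [|k] kK wk kmin.
      by rewrite mul0n expr0; have /andP[] := w01 i0.
    rewrite ltNge; apply/negP => h; have := kmin k; rewrite h (ltnW kK) => /(_ isT).
    by rewrite ltnn.
  exists k => //; split => // l _; rewrite /box/=.
  have := w01 l; case: eqP => [->|_ /andP[wl0 wl1]].
    by rewrite /cell/= in_itv/= wk wk'.
  case: ifP => lJ; rewrite /= in_itv/= wl0//=.
  have := (EP w01).1 Ew l lJ; rewrite -/p => lt1.
  have tkp : U i0 w ^+ a l <= (t ^+ (k * a l)) ^+ p.
    rewrite -exprM mulnAC exprM lerXn2r ?nnegrE ?exprn_ge0// ltW//.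
    by have /andP[] := w01 i0.
  rewrite ltNge; apply/negP => h; have := lt_le_trans lt1 tkp.
  by rewrite ltNge lerXn2r// ?nnegrE ?exprn_ge0// ltW.
apply: le_trans (le_measure P _ _ CEs) _; rewrite ?inE//.
  by repeat apply: measurableU => //; exact: measurableD.
apply: le_trans (measureU2 _ _ _) _ => //; [exact: measurableU|exact: measurableD|].
rewrite [X in (_ + X)%E](_ : _ = 0%E) ?adde0; last exact: CN0.
apply: le_trans (measureU2 _ _ _) _ => //.
rewrite [X in (_ + X)%E](_ : _ = (c * t ^+ (K * p))%:E); last exact: PZ.
rewrite EFinD leeD2r// -sumEFin measure_bigsetU//; last exact: boxed_cell_trivIset.
by rewrite le_eqVlt; apply/orP; left; apply/eqP/eq_bigr => k _; exact: PL.
Qed.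

Lemma competing_clocks :
  P (C `&` E) = (P C * ((a i0)%:R / (a i0 + \sum_(j in J) a j)%:R)%:E)%E.
Proof.
have S0 : (0 < S)%N by rewrite addn_gt0 a0.
have pS : (0 < p <= S)%N by rewrite a0 leq_addr.
have mCE : measurable (C `&` E) by exact: measurableI.
have y0 : 0 <= fine (P (C `&` E)) by exact: fine_ge0.
rewrite cE -EFinM -[LHS]fineK ?fin_num_measure//; congr EFin.
rewrite mulrA -/S -/p; apply: (canRL (mulfK _)); first by rewrite pnatr_eq0 -lt0n.
apply/eqP; rewrite eq_le; apply/andP; split.
  apply: geometric_ge => // t K t01; exact: competing_upper.
by apply: geometric_le => // t K t01; exact: competing_lower.
Qed.

End CompetingClocks.

(** * Probability of a service under either algorithm *)

Section Served.
Variables (dT : measure_display) (T : measurableType dT) (R : realType) (d n : nat).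
Implicit Types (x : state d n) (i j : torus d n).

Lemma measurable_served alg x (u : T -> torus d n -> R) i :
  (forall j, measurable_fun setT (u ^~ j)) ->
  measurable [set w | served alg x (u w) i].
Proof.
move=> mu; rewrite /served; case: (ltnP 0 (x i)) => [x0|_] /=; last first.
  by rewrite (_ : [set _ | _] = set0) ?measurable0//; apply/seteqP; split.
case: alg.
  have mclock j : measurable_fun setT (fun w => clock x (u w) j).
    rewrite /clock; case: eqP => _; first exact: measurable_cst.
    under eq_fun do rewrite muleC.
    apply: measurable_funeM; apply: measurableT_comp => //.
    have -> : (fun w => lne (u w j)%:E)
        = (fun w => if u w j <= 0 then -oo%E else (ln (u w j))%:E) by [].
    apply: measurable_fun_ifT => //; first exact: measurable_fun_ler.
    by apply/measurable_EFinP; exact: measurableT_comp.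
  have -> : [set w | [forall j in nbhd i :\ i, (clock x (u w) i < clock x (u w) j)%E]]
      = \bigcap_(j in [set` nbhd i :\ i]) [set w | (clock x (u w) i < clock x (u w) j)%E].
    apply/seteqP; split=> w /= => [/forall_inP//|h].
    by apply/forall_inP.
  apply: fin_bigcap_measurable => // j _.
  by rewrite -[X in measurable X]setTI; exact: measurable_lte.
have := measurable_fun_ltr (mu i) (measurable_cst (service_rate R x i)).
move=> /(_ measurableT [set true]); rewrite setTI; exact.
Qed.

Variables (P : probability T R) (U : torus d n -> {RV P >-> R}) (C : set T).
Hypothesis mC : measurable C.
Hypothesis indepC : forall B : torus d n -> set R, (forall i, measurable (B i)) ->
  P (C `&` \bigcap_i (U i @^-1` B i)) = (P C * \prod_i uniform_prob (@ltr01 R) (B i))%E.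

(** (D1) is the race lemma; (D2) is the uniform law, the rate being between 0 and 1. The state [x]
    is a fixed parameter, so that only the clocks are random in the second event. *)
Lemma measure_served alg x i :
  P (C `&` [set w | served alg x (U ^~ w) i]) = (P C * (service_rate R x i)%:E)%E.
Proof.
have mserved : measurable [set w | served alg x (U ^~ w) i].
  by apply: (@measurable_served alg x (fun w => U ^~ w)) => j; exact: measurable_funP.
have [x0|x0] := posnP (x i).
  rewrite /served x0 (_ : [set _ | _] = set0); last by apply/seteqP; split.
  by rewrite setI0 measure0 /service_rate x0 mul0r mule0.
case: alg mserved => [mserved|_].
  have SE : (\sum_(j in nbhd i) x j = x i + \sum_(j in nbhd i :\ i) x j)%N.
    by rewrite (big_setD1 i) ?nbhd_refl.
  rewrite /service_rate SE; apply: (competing_clocks mC indepC); rewrite ?setD11//.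
  move=> w w01; rewrite /= /served x0 /=.
  have clockE j : j \in nbhd i :\ i ->
      (clock x (U ^~ w) i < clock x (U ^~ w) j)%E = (U j w ^+ x i < U i w ^+ x j).
    have /andP[ui0 ui1] := w01 i; have /andP[uj0 uj1] := w01 j.
    (* An empty competitor has clock [+oo] and always loses, in agreement with U_j ^ x_i < 1. *)
    rewrite /clock gtn_eqF// !lne_EFin// => _; case: eqP => [->|/eqP xj0].
      rewrite -EFinN -EFinM ltry expr0 exprn_ilt1// ?ltW//.
      by rewrite -lt0n.
    have {}xj0 : 0 < (x j)%:R :> R by rewrite ltr0n lt0n.
    have xi0 : 0 < (x i)%:R :> R by rewrite ltr0n.
    rewrite -!EFinN -!EFinM lte_fin -ltr_ln ?posrE ?exprn_gt0// !lnXn//.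
    rewrite ltr_pdivrMr// mulrAC ltr_pdivlMr// !mulNr ltrN2.
    by rewrite -[ln (U j w) *+ _]mulr_natr -[ln (U i w) *+ _]mulr_natr.
  split=> [/forall_inP h j jJ|h].
    by rewrite -clockE// h.
  by apply/forall_inP => j jJ; rewrite clockE// h.
pose B l : set R := if l == i then `]-oo, service_rate R x i[%classic else setT.
have mB l : measurable (B l).
  by rewrite /B; case: eqP => _; [exact: measurable_itv|exact: measurableT].
rewrite [X in C `&` X](_ : _ = \bigcap_l (U l @^-1` B l)); last first.
  apply/seteqP; split=> w /=; rewrite /served x0 /=.
    by move=> ui l _; rewrite /B/=; case: eqP => // ->; rewrite /= in_itv.
  by move=> /(_ i Logic.I); rewrite /B eqxx/= in_itv.
rewrite indepC//; congr (_ * _)%E; rewrite (bigD1 i)//= big1 => [|l li]; last first.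
  rewrite /B (negbTE li) uniform_probE// setTI lebesgue_measure_itv/= lte_fin ltr01.
  by rewrite sube0.
rewrite mule1 /B eqxx uniform_probE//; have psi0 := service_rate_ge0 R x i.
have psi1 := service_rate_le1 R x i.
rewrite (_ : _ `&` _ = `[0, service_rate R x i[%classic); last first.
  apply/seteqP; split=> r /=; rewrite !in_itv/=; first by move=> [-> /andP[-> _]].
  by move=> /andP[-> rp]; rewrite rp; split => //=; apply: le_trans (ltW rp) psi1.
rewrite lebesgue_measure_itv/= lte_fin; move: psi0; rewrite le_eqVlt => /predU1P[<-|->].
  by rewrite ltxx.
by rewrite sube0.
Qed.

End Served.

(** * Joint laws of the sources in one slot *)

Section NatIntegral.
Variables (dT : measure_display) (T : measurableType dT) (R : realType).
Variables (P : {measure set T -> \bar R}) (F : set T).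
Hypothesis mF : measurable F.
Implicit Types (g : T -> nat) (b : T -> bool).
Local Open Scope ereal_scope.

Lemma discrete_mfun_nat g D : discrete_mfun g ->
  measurable_fun D (fun w => ((g w)%:R%R : R)%:E).
Proof. by move=> mg; exact: (@discrete_mfunW _ _ _ _ _ g (fun m => (m%:R%R : R)%:E)). Qed.

Lemma discrete_mfun_bool b : measurable [set w | b w] -> discrete_mfun b.
Proof.
move=> mb; apply: discrete_mfunP => -[].
  exact: mb.
have -> : b @^-1` [set false] = ~` [set w | b w].
  by apply/seteqP; split=> w /= => [->//|/negP/negbTE].
exact: measurableC.
Qed.

Lemma discrete_mfun2 (K L M : countType) (f : T -> K) (g : T -> L) (op : K -> L -> M) :
  discrete_mfun f -> discrete_mfun g -> discrete_mfun (fun w => op (f w) (g w)).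
Proof.
move=> mf mg.
exact: (discrete_mfun_comp (fun u => op u.1 u.2) (discrete_mfun_pair mf mg)).
Qed.

Lemma discrete_mfun_sum (I : finType) (A : pred I) (g : I -> T -> nat) :
  (forall i, discrete_mfun (g i)) -> discrete_mfun (fun w => \sum_(i in A) g i w)%N.
Proof.
move=> mg; have -> : (fun w => \sum_(i in A) g i w)%N
    = (fun f : {ffun I -> nat} => \sum_(i in A) f i)%N \o (fun w => [ffun i => g i w]).
  by apply/funext => w /=; apply: eq_bigr => i _; rewrite ffunE.
by apply: discrete_mfun_comp; exact: discrete_mfun_ffun.
Qed.

Lemma discrete_mfun_cst (K : Type) (c : K) : discrete_mfun (fun _ : T => c).
Proof. by move=> A; rewrite preimage_cst; case: ifP. Qed.

Lemma discrete_mfunZ c g : discrete_mfun g -> discrete_mfun (fun w => c * g w)%N.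
Proof. by move=> mg; exact: (discrete_mfun_comp (muln c) mg). Qed.

Lemma discrete_mfunD g1 g2 : discrete_mfun g1 -> discrete_mfun g2 ->
  discrete_mfun (fun w => g1 w + g2 w)%N.
Proof. exact: discrete_mfun2. Qed.

(** Integrands are kept in [nat]: they are then nonnegative, and linearity asks for no
    integrability. *)
Lemma natintegralD g1 g2 : discrete_mfun g1 -> discrete_mfun g2 ->
  \int[P]_(w in F) ((g1 w + g2 w)%:R%R : R)%:E =
  \int[P]_(w in F) ((g1 w)%:R%R)%:E + \int[P]_(w in F) ((g2 w)%:R%R)%:E.
Proof.
move=> m1 m2; under eq_integral do rewrite natrD EFinD.
by rewrite ge0_integralD//; try exact: discrete_mfun_nat; move=> w _; rewrite lee_fin.
Qed.

Lemma natintegral_sum (I : finType) (A : pred I) (g : I -> T -> nat) :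
  (forall i, discrete_mfun (g i)) ->
  \int[P]_(w in F) ((\sum_(i in A) g i w)%:R%R : R)%:E =
  \sum_(i in A) \int[P]_(w in F) ((g i w)%:R%R)%:E.
Proof.
move=> mg; under eq_integral do rewrite -big_enum natr_sum -sumEFin.
rewrite (ge0_integral_sum P mF (f := fun i w => ((g i w)%:R%R)%:E)) ?big_enum//.
by move=> i; exact: discrete_mfun_nat.
Qed.

Lemma natintegralZ c g : discrete_mfun g ->
  \int[P]_(w in F) ((c * g w)%:R%R : R)%:E = c%:R%:E * \int[P]_(w in F) ((g w)%:R%R)%:E.
Proof.
move=> mg; under eq_integral do rewrite natrM EFinM.
by rewrite ge0_integralZl ?lee_fin//; exact: discrete_mfun_nat.
Qed.

Lemma natintegral_le g1 g2 : discrete_mfun g1 -> discrete_mfun g2 ->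
  (forall w, F w -> (g1 w <= g2 w)%N) ->
  \int[P]_(w in F) ((g1 w)%:R%R : R)%:E <= \int[P]_(w in F) ((g2 w)%:R%R)%:E.
Proof.
move=> m1 m2 le12; apply: ge0_le_integral => //; try exact: discrete_mfun_nat.
by move=> w Fw; rewrite lee_fin ler_nat le12.
Qed.

Lemma natintegralMb g b :
  \int[P]_(w in F) ((g w * b w)%:R%R : R)%:E =
  \int[P]_(w in F `&` [set w | b w]) ((g w)%:R%R)%:E.
Proof.
rewrite integral_mkcondr; apply: eq_integral => w _; rewrite patchE.
case: ifPn => [|]; first by rewrite inE/= => ->; rewrite muln1.
by rewrite notin_setE/= => /negP/negbTE ->; rewrite muln0.
Qed.

Lemma natintegral_bool b : measurable [set w | b w] ->
  \int[P]_(w in F) ((b w : nat)%:R%R : R)%:E = P (F `&` [set w | b w]).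
Proof.
move=> mb; under eq_integral do rewrite -[nat_of_bool _]mul1n.
rewrite natintegralMb integral_cst ?mul1e//; exact: measurableI.
Qed.

End NatIntegral.

Ltac discrete_mfun_linear :=
  repeat first [assumption | exact: discrete_mfun_cst
    | refine (discrete_mfunZ _ _) | refine (discrete_mfunD _ _)].

Section Independence.
Variables (R : realType) (d n : nat) (q : R) (alg : algorithm) (mu : probability nat R).
Variables (dT : measure_display) (T : measurableType dT) (P : probability T R).
Variables (X : nat -> T -> state d n) (xi : nat -> torus d n -> {RV P >-> nat}).
Variables (U : nat -> torus d n -> {RV P >-> R}).
Variable route : nat -> torus d n -> T -> option (torus d n).
Hypothesis hmodel : multihop X xi U route alg q mu.
Implicit Types (A : torus d n -> set nat) (B : torus d n -> set R).
Implicit Types (D : torus d n -> set (option (torus d n))) (Y : set (state d n)).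
Local Open Scope ereal_scope.

Lemma discrete_mfun_initial : discrete_mfun (X 0%N).
Proof. exact: (initial_measurable hmodel). Qed.

Lemma discrete_mfun_arrival k i : discrete_mfun (xi k i).
Proof. by move=> A; rewrite -[_ @^-1` _]setTI; exact: measurable_funP. Qed.

Lemma discrete_mfun_route k i : discrete_mfun (route k i).
Proof. exact: (route_measurable hmodel). Qed.

Lemma measurable_served0 x i : measurable [set w | served alg x (U 0%N ^~ w) i].
Proof.
by apply: (@measurable_served _ _ _ _ _ alg x (fun w => U 0%N ^~ w)) => j; exact: measurable_funP.
Qed.

(** The clocks are left out, so that this event can play the part of [C] in [measure_served]. *)
Definition sources_event Y A D : set T :=
  X 0%N @^-1` Y `&` \bigcap_i (xi 0%N i @^-1` A i) `&` \bigcap_i (route 0%N i @^-1` D i).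

Lemma measurable_sources_event Y A D : measurable (sources_event Y A D).
Proof.
apply: measurableI; [apply: measurableI|].
- exact: discrete_mfun_initial.
- by apply: fin_bigcap_measurable => // i _; exact: discrete_mfun_arrival.
- by apply: fin_bigcap_measurable => // i _; exact: discrete_mfun_route.
Qed.

Lemma sources_rectangle Y A D B : (forall i, measurable (B i)) ->
  P (sources_event Y A D `&` \bigcap_i (U 0%N i @^-1` B i)) =
  P (X 0%N @^-1` Y) * (\prod_i mu (A i) * \prod_i P (route 0%N i @^-1` D i))
  * \prod_i uniform_prob (@ltr01 R) (B i).
Proof.
move=> mB.
(* Finite index type of the sources of slot 0; its enumeration is the injective family that
   [mutually_independent] asks for. *)
pose S := (unit + (torus d n + (torus d n + torus d n)))%type.
pose src (s : S) : source d n := match s with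
  | inl _ => Initial _ _
  | inr (inl i) => Arrival 0 i
  | inr (inr (inl i)) => Routing 0 i
  | inr (inr (inr i)) => Clock 0 i
  end.
pose ev (s : S) : set T := match s with
  | inl _ => X 0%N @^-1` Y
  | inr (inl i) => xi 0%N i @^-1` A i
  | inr (inr (inl i)) => route 0%N i @^-1` D i
  | inr (inr (inr i)) => U 0%N i @^-1` B i
  end.
have src_inj : injective src.
  by move=> [[]|[i|[i|i]]] [[]|[j|[j|j]]] //= [->].
have srcE s : source_events X xi U route (src s) (ev s).
  case: s => [[]|[i|[i|i]]] /=.
  - by exists Y; rewrite ?setTI.
  - by exists (A i); rewrite ?setTI.
  - by exists (D i); rewrite ?setTI.
  - by exists (B i); rewrite ?setTI.
pose ix : 'I_#|{: S}| -> S := @enum_val _ (mem {: S}).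
have prodE : \prod_l P (ev (ix l)) = \prod_(s : S) P (ev s).
  by rewrite -(big_enum_val (A := mem {: S}) (fun s => P (ev s))); exact: eq_bigl.
have := sources_independent hmodel (J := src \o ix) (E := ev \o ix)
  (inj_comp src_inj (@enum_val_inj _ _)) (fun l => srcE (ix l)).
rewrite /= prodE big_sumType big_sumType big_sumType/=.
have -> : \bigcap_l (ev \o ix) l = sources_event Y A D `&` \bigcap_i (U 0%N i @^-1` B i).
  apply/seteqP; split=> [w h|w [[[h1 h2] h3] h4] l _ /=].
    have {}h s : ev s w by have := h (enum_rank s) Logic.I; rewrite /= /ix enum_rankK.
    split; first split; first split.
    - exact: (h (inl tt)).
    - by move=> i _; exact: (h (inr (inl i))).
    - by move=> i _; exact: (h (inr (inr (inl i)))).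
    - by move=> i _; exact: (h (inr (inr (inr i)))).
  case: (ix l) => [[]|[i|[i|i]]] /=; first exact: h1.
  - exact: h2.
  - exact: h3.
  - exact: h4.
move=> ->; rewrite big_const card_unit/= mule1 -!muleA; congr (_ * (_ * (_ * _))).
  by apply: eq_bigr => i _; rewrite (arrival_law hmodel).
by apply: eq_bigr => i _; rewrite (clock_law hmodel).
Qed.

Lemma uniform_setT : uniform_prob (@ltr01 R) setT = 1.
Proof. by rewrite uniform_probE// setTI lebesgue_measure_itv/= lte_fin ltr01 sube0. Qed.

Lemma measure_sources_event Y A D :
  P (sources_event Y A D) =
  P (X 0%N @^-1` Y) * (\prod_i mu (A i) * \prod_i P (route 0%N i @^-1` D i)).
Proof.
have := @sources_rectangle Y A D (fun=> setT) (fun=> measurableT).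
rewrite [X in _ `&` X](_ : _ = setT); last by apply/seteqP; split.
by rewrite setIT => ->; rewrite [X in _ * X = _]big1 ?mule1// => i _; exact: uniform_setT.
Qed.

Lemma measure_sources_served Y A D x j :
  P (sources_event Y A D `&` [set w | served alg x (U 0%N ^~ w) j]) =
  P (sources_event Y A D) * (service_rate R x j)%:E.
Proof.
apply: measure_served; first exact: measurable_sources_event.
by move=> B mB; rewrite sources_rectangle// -measure_sources_event.
Qed.

(** The only joint law that the second moment calls for: initial state, one service, the route of
    the same node, one arrival. Every unconstrained source receives [setT]. *)
Lemma joint_law Y x i j (N : set nat) (V : set (option (torus d n))) :
  P (X 0%N @^-1` Y `&` [set w | served alg x (U 0%N ^~ w) j]
     `&` route 0%N j @^-1` V `&` xi 0%N i @^-1` N) =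
  P (X 0%N @^-1` Y) * (service_rate R x j)%:E * P (route 0%N j @^-1` V) * mu N.
Proof.
pose A l := if l == i then N else setT.
pose D l := if l == j then V else setT.
have -> : X 0%N @^-1` Y `&` [set w | served alg x (U 0%N ^~ w) j]
     `&` route 0%N j @^-1` V `&` xi 0%N i @^-1` N =
     sources_event Y A D `&` [set w | served alg x (U 0%N ^~ w) j].
  apply/seteqP; split=> w.
    move=> [[[wX ws] wr] wx]; split=> //; split; first split=> //.
      by move=> l _; rewrite /A; case: eqP => // ->.
    by move=> l _; rewrite /D; case: eqP => // ->.
  move=> [[[wX wA] wD] ws]; split; first split => //.
    by have := wD j Logic.I; rewrite /D eqxx.
  by have := wA i Logic.I; rewrite /A eqxx.
rewrite measure_sources_served measure_sources_event.
rewrite (bigD1 i)//= big1 ?mule1 => [|l li]; last first.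
  by rewrite /A (negbTE li) probability_setT.
rewrite [X in _ * (_ * X)](bigD1 j)//= big1 ?mule1 => [|l lj]; last first.
  by rewrite /D (negbTE lj) preimage_setT probability_setT.
rewrite /A /D !eqxx -!muleA; congr (_ * _).
by rewrite muleA [LHS]muleC [mu N * _]muleC.
Qed.

Lemma joint_law_arrival Y i (N : set nat) :
  P (X 0%N @^-1` Y `&` xi 0%N i @^-1` N) = P (X 0%N @^-1` Y) * mu N.
Proof.
pose A l := if l == i then N else setT.
have -> : X 0%N @^-1` Y `&` xi 0%N i @^-1` N = sources_event Y A (fun=> setT).
  apply/seteqP; split=> w.
    move=> [wX wx]; split=> //; split=> //.
    by move=> l _; rewrite /A; case: eqP => // ->.
  by move=> [[wX wA] wD]; split => //; have := wA i Logic.I; rewrite /A eqxx.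
rewrite measure_sources_event [X in _ * (_ * X)]big1 => [|l _]; last first.
  by rewrite preimage_setT probability_setT.
rewrite (bigD1 i)//= big1 ?mule1 => [|l li]; first by rewrite /A eqxx.
by rewrite /A (negbTE li) probability_setT.
Qed.

Lemma joint_law_served Y x j :
  P (X 0%N @^-1` Y `&` [set w | served alg x (U 0%N ^~ w) j]) =
  P (X 0%N @^-1` Y) * (service_rate R x j)%:E.
Proof.
have := joint_law Y x 0%R j setT setT.
by rewrite !preimage_setT !setIT !probability_setT !mule1.
Qed.

Lemma joint_law_routed Y x i j : torus_adj j i ->
  P (X 0%N @^-1` Y `&` [set w | served alg x (U 0%N ^~ w) j]
     `&` route 0%N j @^-1` [set Some i]) =
  P (X 0%N @^-1` Y) * (service_rate R x j * ((1 - q) / (2 * d)%:R))%:E.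
Proof.
move=> ji; have := joint_law Y x 0%R j setT [set Some i].
rewrite preimage_setT setIT probability_setT mule1 => ->.
by rewrite (routing_law hmodel)// -muleA -EFinM.
Qed.

End Independence.

(** * One-step second moment *)

Section OneStep.
Variables (R : realType) (d n : nat) (q : R) (alg : algorithm) (mu : probability nat R).
Variables (dT : measure_display) (T : measurableType dT) (P : probability T R).
Variables (X : nat -> T -> state d n) (xi : nat -> torus d n -> {RV P >-> nat}).
Variables (U : nat -> torus d n -> {RV P >-> R}).
Variable route : nat -> torus d n -> T -> option (torus d n).
Hypothesis hmodel : multihop X xi U route alg q mu.
Variables (m1 m2 : R).
Local Open Scope ereal_scope.
Hypothesis mean_mu : \int[mu]_m (m%:R%R)%:E = m1%:E.
Hypothesis second_mu : \int[mu]_m ((m ^ 2)%N%:R%R)%:E = m2%:E.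
Implicit Types (x : state d n) (i j : torus d n).

(** Evaluated at a fixed [x] instead of [X 0]: this is independent of [X 0] and agrees with the
    actual service on the fiber [X 0 = x]. *)
Definition service x i w : bool := served alg x (U 0%N ^~ w) i.
Definition transfer x i j w : bool := (route 0%N j w == Some i) && service x j w.
Definition inflow x i w : nat := routed_in alg x (U 0%N ^~ w) (route 0%N ^~ w) i.

Lemma inflowE x i w : inflow x i w = (\sum_(j in nbhd i :\ i) transfer x i j w)%N.
Proof. by apply: eq_bigr => j _; rewrite mulnb. Qed.

Lemma measurable_transfer x i j : measurable [set w | transfer x i j w].
Proof.
rewrite (_ : [set _ | _] = route 0%N j @^-1` [set Some i] `&` [set w | service x j w]).
  by apply: measurableI; [exact: (route_measurable hmodel)|exact: measurable_served0].
by apply/seteqP; split=> w /= => [/andP[/eqP]//|[wr ws]]; rewrite /transfer wr eqxx.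
Qed.

Lemma discrete_mfun_service x i : discrete_mfun (fun w => nat_of_bool (service x i w)).
Proof.
by apply: (discrete_mfun_comp nat_of_bool); apply: discrete_mfun_bool; exact: measurable_served0.
Qed.

Lemma discrete_mfun_transfer x i j : discrete_mfun (fun w => nat_of_bool (transfer x i j w)).
Proof.
by apply: (discrete_mfun_comp nat_of_bool); apply: discrete_mfun_bool; exact: measurable_transfer.
Qed.

Lemma discrete_mfun_inflow x i : discrete_mfun (inflow x i).
Proof.
have -> : inflow x i = (fun w => \sum_(j in nbhd i :\ i) transfer x i j w)%N.
  by apply/funext => w; exact: inflowE.
by apply: discrete_mfun_sum => j; exact: discrete_mfun_transfer.
Qed.

Variable x : state d n.
Let F := X 0%N @^-1` [set x].
Let mF : measurable F. Proof. exact: (initial_measurable hmodel). Qed.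
Let p := fine (P F).
Let pE : P F = p%:E. Proof. by rewrite fineK// fin_num_measure. Qed.

Lemma setI_transfer i j : F `&` [set w | transfer x i j w] =
  F `&` [set w | service x j w] `&` route 0%N j @^-1` [set Some i].
Proof.
by apply/seteqP; split=> w /= => [[wF /andP[/eqP]]//|[[wF ws] wr]]; rewrite /transfer wr eqxx.
Qed.

Lemma measure_service i : P (F `&` [set w | service x i w]) = (p * service_rate R x i)%:E.
Proof. by rewrite EFinM -pE; exact: (joint_law_served hmodel). Qed.

Lemma integral_service i : \int[P]_(w in F) ((service x i w : nat)%:R%R)%:E
  = (p * service_rate R x i)%:E.
Proof.
rewrite natintegral_bool//; last exact: measurable_served0.
exact: measure_service.
Qed.

Lemma integral_arrival i (h : nat -> \bar R) : (forall m, 0 <= h m) ->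
  \int[P]_(w in F) h (xi 0%N i w) = p%:E * \int[mu]_m h m.
Proof.
move=> h0; rewrite (@indep_integral _ _ _ _ mu _ (xi 0%N i) mF _ _ h0) ?pE// => N.
rewrite -?pE; exact: (joint_law_arrival hmodel).
Qed.

Lemma integral_arrival_service i :
  \int[P]_(w in F) ((xi 0%N i w * service x i w)%:R%R)%:E
  = (p * (m1 * service_rate R x i))%:E.
Proof.
have mb : measurable [set w | service x i w] by exact: measurable_served0.
rewrite natintegralMb (@indep_integral _ _ _ _ mu _ (xi 0%N i) _ _ (fun m => (m%:R%R)%:E)).
- by rewrite mean_mu measure_service -EFinM -mulrA [(m1 * _)%R]mulrC.
- exact: measurableI.
- move=> N; have := joint_law hmodel [set x] x i i N setT.
  by rewrite preimage_setT setIT probability_setT mule1 -/F pE -EFinM -measure_service.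
- by move=> m; rewrite lee_fin.
Qed.

Lemma measure_transfer i j : j \in nbhd i :\ i ->
  P (F `&` [set w | transfer x i j w])
  = (p * ((1 - q) / (2 * d)%:R * service_rate R x j))%:E.
Proof.
move=> ij; rewrite setI_transfer (joint_law_routed hmodel) -/F ?pE.
  by rewrite -EFinM [(_ * (_ / _))%R]mulrC.
by rewrite torus_adj_sym; exact: nbhdD1_adj.
Qed.

Lemma integral_inflow i :
  \int[P]_(w in F) ((inflow x i w)%:R%R)%:E = (p * transfer_rate q x i)%:E.
Proof.
under eq_integral do rewrite inflowE.
rewrite natintegral_sum//; last by move=> j; exact: discrete_mfun_transfer.
rewrite /transfer_rate !big_distrr/= -sumEFin; apply: eq_bigr => j ij.
by rewrite (natintegral_bool _ mF (measurable_transfer x i j)); exact: measure_transfer.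
Qed.

Lemma integral_arrival_inflow i :
  \int[P]_(w in F) ((xi 0%N i w * inflow x i w)%:R%R)%:E
  = (p * (m1 * transfer_rate q x i))%:E.
Proof.
under eq_integral do rewrite inflowE big_distrr/=.
rewrite natintegral_sum//; last first.
  move=> j; apply: (discrete_mfun2 muln); first exact: discrete_mfun_arrival.
  exact: discrete_mfun_transfer.
rewrite /transfer_rate !big_distrr/= -sumEFin; apply: eq_bigr => j ij.
have mb := measurable_transfer x i j.
rewrite natintegralMb (@indep_integral _ _ _ _ mu _ (xi 0%N i) _ _ (fun m => (m%:R%R)%:E)).
- by rewrite mean_mu measure_transfer// -EFinM; congr EFin; ring.
- exact: measurableI.
- move=> N; rewrite measure_transfer// setI_transfer.
  apply: etrans (joint_law hmodel [set x] x i j N [set Some i]) _; congr (_ * _).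
  rewrite (routing_law hmodel); last by rewrite torus_adj_sym; exact: nbhdD1_adj.
  by rewrite -/F pE -!EFinM -mulrA [(service_rate _ _ _ * _)%R]mulrC.
- by move=> m; rewrite lee_fin.
Qed.

Lemma next_initial w : F w ->
  X 1%N w = next_state alg x (xi 0%N ^~ w) (U 0%N ^~ w) (route 0%N ^~ w).
Proof. by move=> Fw; rewrite (evolution hmodel) (_ : X 0%N w = x). Qed.

Hypothesis mX1 : discrete_mfun (X 1%N).

Lemma integral_next_sqr i : \int[P]_(w in F) ((X 1%N w i ^ 2)%N%:R%R)%:E <=
  (p * ((x i ^ 2)%:R + 2 * ((x i)%:R * (m1 + transfer_rate q x i - service_rate R x i))
        + m2 + (2 * d)%:R * transfer_rate q x i + service_rate R x i
        + 2 * m1 * transfer_rate q x i - 2 * m1 * service_rate R x i))%:E.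
Proof.
have mxi := discrete_mfun_arrival xi 0 i.
have ms := discrete_mfun_service x i.
have mA := discrete_mfun_inflow x i.
have mxis : discrete_mfun (fun w => xi 0%N i w * service x i w)%N by exact: discrete_mfun2.
have mxiA : discrete_mfun (fun w => xi 0%N i w * inflow x i w)%N by exact: discrete_mfun2.
have mxi2 : discrete_mfun (fun w => xi 0%N i w ^ 2)%N.
  exact: (discrete_mfun_comp (fun m => m ^ 2)%N mxi).
have mX2 : discrete_mfun (fun w => X 1%N w i ^ 2)%N.
  exact: (discrete_mfun_comp (fun y : state d n => y i ^ 2)%N mX1).
(* The pathwise inequality is integrated with its negative terms on the left, since finiteness of
   the second moment of [X 1] is not yet known. *)
have : \int[P]_(w in F) ((X 1%N w i ^ 2 + 2 * x i * service x i w
      + 2 * (xi 0%N i w * service x i w))%:R%R : R)%:E <=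
    \int[P]_(w in F) ((x i ^ 2 + 2 * x i * xi 0%N i w + 2 * x i * inflow x i w
      + xi 0%N i w ^ 2 + 2 * d * inflow x i w + service x i w
      + 2 * (xi 0%N i w * inflow x i w))%:R%R)%:E.
  apply: natintegral_le => //;
    try by discrete_mfun_linear.
  move=> w Fw; have := next_state_sqr alg x (xi 0%N ^~ w) (U 0%N ^~ w) (route 0%N ^~ w) i.
  by rewrite -(next_initial Fw) /= -!mulnA.
have intD g1 g2 : discrete_mfun g1 -> discrete_mfun g2 ->
    \int[P]_(w in F) ((g1 w + g2 w)%:R%R : R)%:E =
    \int[P]_(w in F) ((g1 w)%:R%R)%:E + \int[P]_(w in F) ((g2 w)%:R%R)%:E.
  exact: natintegralD.
have intZ c g : discrete_mfun g -> \int[P]_(w in F) ((c * g w)%:R%R : R)%:E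
    = c%:R%:E * \int[P]_(w in F) ((g w)%:R%R)%:E by exact: natintegralZ.
rewrite (intD (fun w => X 1%N w i ^ 2 + 2 * x i * service x i w)%N _); try by discrete_mfun_linear.
rewrite (intD (fun w => X 1%N w i ^ 2)%N _); try by discrete_mfun_linear.
rewrite (intD (fun w => _ + _)%N (fun w => 2 * (xi 0%N i w * inflow x i w))%N); try by discrete_mfun_linear.
rewrite (intD (fun w => _ + _)%N (fun w => nat_of_bool (service x i w))); try by discrete_mfun_linear.
rewrite (intD (fun w => _ + _)%N (fun w => 2 * d * inflow x i w)%N); try by discrete_mfun_linear.
rewrite (intD (fun w => _ + _)%N (fun w => xi 0%N i w ^ 2)%N); try by discrete_mfun_linear.
rewrite (intD (fun w => _ + _)%N (fun w => 2 * x i * inflow x i w)%N); try by discrete_mfun_linear.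
rewrite (intD (fun w => x i ^ 2)%N (fun w => 2 * x i * xi 0%N i w)%N); try by discrete_mfun_linear.
rewrite !(intZ _ (fun w => nat_of_bool (service x i w)))//.
rewrite !(intZ _ (fun w => inflow x i w))// !(intZ _ (fun w => xi 0%N i w))//.
rewrite (intZ _ (fun w => xi 0%N i w * service x i w)%N)//.
rewrite (intZ _ (fun w => xi 0%N i w * inflow x i w)%N)//.
rewrite !integral_service !integral_inflow integral_arrival_inflow.
rewrite integral_arrival_service (integral_arrival i (h := fun m => (m%:R%R)%:E)); last first.
  by move=> m; rewrite lee_fin.
rewrite (integral_arrival i (h := fun m => ((m ^ 2)%N%:R%R)%:E)); last first.
  by move=> m; rewrite lee_fin.
have -> : \int[P]_(w in F) ((x i ^ 2)%N%:R%R)%:E = ((x i ^ 2)%N%:R * p)%:E.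
  by rewrite (integral_cst P mF ((x i ^ 2)%N%:R)%:E) EFinM; congr (_ * _); exact: pE.
rewrite mean_mu second_mu.
(* All other integrals are now real numbers, so the inequality itself excludes [+oo] and the terms
   can be moved back. *)
rewrite -!EFinM -!EFinD; case: (\int[P]_(w in F) _) => [r| |] //.
  rewrite -!EFinD !lee_fin !natrM; lra.
by move=> _; exact: leNye.
Qed.

End OneStep.

(** * Drift and flow balance under a stationary law *)

Section StationaryDrift.
Variables (R : realType) (d n : nat) (q : R) (alg : algorithm) (mu : probability nat R).
Hypotheses (d_gt0 : (0 < d)%N) (q01 : 0 < q < 1).
Variables (dT : measure_display) (T : measurableType dT) (P : probability T R).
Variables (X : nat -> T -> state d n) (xi : nat -> torus d n -> {RV P >-> nat}).
Variables (U : nat -> torus d n -> {RV P >-> R}).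
Variable route : nat -> torus d n -> T -> option (torus d n).
Hypothesis hmodel : multihop X xi U route alg q mu.
Hypothesis hstat : stationary P X.
Variables (lambda m2 : R).
Let m1 := lambda * q.
Hypothesis mean_mu : (\int[mu]_m (m%:R%R)%:E = m1%:E)%E.
Hypothesis second_mu : (\int[mu]_m ((m ^ 2)%N%:R%R)%:E = m2%:E)%E.
Hypothesis lambda_lt : lambda < (2 * d + 1)%:R^-1.
Hypothesis mX1 : discrete_mfun (X 1%N).
Implicit Types (x : state d n) (i j : torus d n).
Local Open Scope ereal_scope.

Let eps := (q * ((2 * d + 1)%:R^-1 - lambda))%R.
Let N := #|{: torus d n}|.
Let mX0 : discrete_mfun (X 0%N). Proof. exact: discrete_mfun_initial hmodel. Qed.

Definition queue_total x : nat := (\sum_i x i)%N.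
Definition queue_sqr x : nat := (\sum_i x i ^ 2)%N.
Definition total_service x : R := (\sum_i service_rate R x i)%R.
Definition total_transfer x : R := (\sum_i transfer_rate q x i)%R.
(** The function h of the drift. The coefficient 2 d comes from bounding the squared inflow, the
    coefficient 1 from the square of a service indicator, and both 2 m1 from products with an
    independent arrival. *)
Definition second_order x : R :=
  (N%:R * m2 + ((2 * d)%:R + 2 * m1) * total_transfer x + (1 - 2 * m1) * total_service x)%R.

Lemma m1_ge0 : (0 <= m1)%R.
Proof. by rewrite -lee_fin -mean_mu integral_ge0// => m _; rewrite lee_fin. Qed.

Lemma m2_ge0 : (0 <= m2)%R.
Proof. by rewrite -lee_fin -second_mu integral_ge0// => m _; rewrite lee_fin. Qed.

(** With d >= 1, lambda is below 1/3. This keeps the coefficient 1 - 2 m1 nonnegative, and later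
    forces an arrival to vanish with positive probability. *)
Lemma m1_lt : (m1 < 3^-1)%R.
Proof.
case/andP: q01 => q0 q1; have l0 : (0 <= lambda)%R.
  by have := m1_ge0; rewrite /m1 pmulr_lge0.
have d3 : ((2 * d + 1)%:R^-1 <= 3^-1 :> R)%R.
  by rewrite lef_pV2 ?posrE ?ltr0n ?addn1// ler_nat ltnS; case: (d) d_gt0 => // k _; rewrite mulnS.
by rewrite /m1 (le_lt_trans (ler_piMr l0 (ltW q1)))// (lt_le_trans lambda_lt).
Qed.

Lemma eps_gt0 : (0 < eps)%R.
Proof. by rewrite mulr_gt0 ?subr_gt0//; case/andP: q01. Qed.

Lemma total_service_ge0 x : (0 <= total_service x)%R.
Proof. by apply: sumr_ge0 => i _; exact: service_rate_ge0. Qed.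

Lemma total_transfer_ge0 x : (0 <= total_transfer x)%R.
Proof. by apply: sumr_ge0 => i _; exact: transfer_rate_ge0. Qed.

Lemma total_service_le x : (total_service x <= N%:R)%R.
Proof.
rewrite /total_service (le_trans (ler_sum _ (fun i _ => service_rate_le1 R x i)))//.
by rewrite sumr_const.
Qed.

Lemma total_transfer_le x : (total_transfer x <= (1 - q) * total_service x)%R.
Proof. exact: sum_transfer_rate. Qed.

Lemma second_order_ge0 x : (0 <= second_order x)%R.
Proof.
have := m1_lt; have := m1_ge0; have := m2_ge0 => m20 m10 m13.
apply: addr_ge0; first (apply: addr_ge0; first exact: mulr_ge0).
  by rewrite mulr_ge0 ?total_transfer_ge0// addr_ge0// mulr_ge0.
by rewrite mulr_ge0 ?total_service_ge0// subr_ge0; lra.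
Qed.

Lemma integral_next_queue_sqr x :
  \int[P]_(w in X 0%N @^-1` [set x]) ((queue_sqr (X 1%N w))%:R%R : R)%:E <=
  (fine (P (X 0%N @^-1` [set x])) *
   ((queue_sqr x)%:R - 2 * eps * (queue_total x)%:R + second_order x))%:E.
Proof.
have mx : measurable (X 0%N @^-1` [set x]) by exact: mX0.
have -> : \int[P]_(w in X 0%N @^-1` [set x]) ((queue_sqr (X 1%N w))%:R%R : R)%:E
    = \sum_i \int[P]_(w in X 0%N @^-1` [set x]) ((X 1%N w i ^ 2)%N%:R%R)%:E.
  apply: (natintegral_sum P mx predT) => i.
  exact: (discrete_mfun_comp (fun y : state d n => y i ^ 2)%N mX1).
apply: le_trans (lee_sum _ (fun i _ => integral_next_sqr hmodel mean_mu second_mu x mX1 i)) _.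
rewrite sumEFin -big_distrr/= lee_fin ler_wpM2l// ?fine_ge0//.
have := drift_le d_gt0 q01 x lambda; rewrite -/m1 -/eps.
rewrite /second_order /total_transfer /total_service /queue_sqr /queue_total !natr_sum.
move: (transfer_rate q x) (service_rate R x) => al psi.
rewrite !sumrB !big_split/= -!big_distrr/= sumr_const -/N -[(m2 *+ N)%R]mulr_natl; lra.
Qed.

Let mint (h : state d n -> R) D : measurable_fun D (fun w => (h (X 0%N w))%:E).
Proof. exact: (@discrete_mfunW _ _ _ _ _ _ (fun y => (h y)%:E) _ mX0). Qed.

Let mint1 (h : state d n -> R) D : measurable_fun D (fun w => (h (X 1%N w))%:E).
Proof. exact: (@discrete_mfunW _ _ _ _ _ _ (fun y => (h y)%:E) _ mX1). Qed.

Lemma truncated_drift M (D := [set x | (queue_sqr x <= M)%N]) :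
  \int[P]_(w in X 0%N @^-1` D) (2 * eps * (queue_total (X 0%N w))%:R)%:E <=
  \int[P]_(w in X 0%N @^-1` D) (second_order (X 0%N w))%:E.
Proof.
have e0 := eps_gt0.
have mD : measurable (X 0%N @^-1` D) by exact: mX0.
pose W2 x : R := (2 * eps * (queue_total x)%:R)%R.
have W20 x : (0 <= W2 x)%R by apply: mulr_ge0 => //; apply: mulr_ge0 => //; exact: ltW.
have step : \int[P]_(w in X 0%N @^-1` D) ((queue_sqr (X 1%N w))%:R%:E + (W2 (X 0%N w))%:E)
  <= \int[P]_(w in X 0%N @^-1` D) ((queue_sqr (X 0%N w))%:R%:E + (second_order (X 0%N w))%:E).
  apply: (@le_integral_fibers _ _ _ P _ _ mX0).
  - by apply: emeasurable_funD; [exact: (mint1 (fun y => (queue_sqr y)%:R))|exact: mint].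
  - by apply: emeasurable_funD; [exact: (mint (fun y => (queue_sqr y)%:R))|exact: mint].
  - by move=> w; rewrite -EFinD lee_fin addr_ge0.
  - by move=> w; rewrite -EFinD lee_fin addr_ge0// second_order_ge0.
  move=> x; have mx : measurable (X 0%N @^-1` [set x]) by exact: mX0.
  rewrite (ge0_integralD P mx _ (@mint1 (fun y => (queue_sqr y)%:R) _) _ (@mint W2 _)); last 2 first.
  - by move=> w _; rewrite lee_fin.
  - by move=> w _; rewrite lee_fin.
  have cstx (h : state d n -> R) : \int[P]_(w in X 0%N @^-1` [set x]) (h (X 0%N w))%:E
      = (fine (P (X 0%N @^-1` [set x])) * h x)%:E.
    transitivity (\int[P]_(w in X 0%N @^-1` [set x]) (h x)%:E).
      by apply: eq_integral => w; rewrite inE => /= ->.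
    by rewrite integral_cst// EFinM muleC fineK ?fin_num_measure.
  under [leRHS]eq_integral do rewrite -EFinD.
  rewrite cstx (cstx (fun y => (queue_sqr y)%:R + second_order y)%R).
  apply: le_trans (leeD2r _ (integral_next_queue_sqr x)) _.
  by rewrite -EFinD lee_fin -mulrDr ler_wpM2l ?fine_ge0// /W2; lra.
(* The means of min(V, M) at times 0 and 1 agree. Off [D] the former equals M and dominates the
   latter, so on [D] the order is reversed, and there min(V, M) is V at time 0 and at most V at time
   1. *)
have trunc : \int[P]_(w in X 0%N @^-1` D) (queue_sqr (X 0%N w))%:R%:E
   <= \int[P]_(w in X 0%N @^-1` D) (queue_sqr (X 1%N w))%:R%:E.
  have mDC : measurable (~` (X 0%N @^-1` D)) by exact: measurableC.
  have MP : M%:R%:E * P (~` (X 0%N @^-1` D)) \is a fin_num.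
    by rewrite fin_numM// fin_num_measure.
  have split_int (k : nat) (mXk : discrete_mfun (X k)) :
      \int[P]_w (minn (queue_sqr (X k w)) M)%:R%:E =
      \int[P]_(w in X 0%N @^-1` D) (minn (queue_sqr (X k w)) M)%:R%:E
      + \int[P]_(w in ~` (X 0%N @^-1` D)) (minn (queue_sqr (X k w)) M)%:R%:E.
    rewrite -(setUv (X 0%N @^-1` D)) ge0_integral_setU//.
      exact: (@discrete_mfunW _ _ _ _ _ _ (fun y => (minn (queue_sqr y) M)%:R%:E) _ mXk).
    by apply/disj_setPS; rewrite setICr.
  have nn (y : state d n) : 0 <= ((minn (queue_sqr y) M)%:R : R)%:E by rewrite lee_fin.
  have := eq_law_integral mX1 mX0 (hstat 1%N) setT nn; rewrite !preimage_setT => stat.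
  rewrite -(leeD2rE _ _ MP).
  have E0 : \int[P]_(w in X 0%N @^-1` D) (queue_sqr (X 0%N w))%:R%:E
      + M%:R%:E * P (~` (X 0%N @^-1` D)) = \int[P]_w (minn (queue_sqr (X 0%N w)) M)%:R%:E.
    rewrite (split_int _ mX0) -(integral_cst P mDC); congr (_ + _).
      by apply: eq_integral => w; rewrite inE/= => /minn_idPl ->.
    apply: eq_integral => w; rewrite inE/= => /negP; rewrite -ltnNge => /ltnW.
    by move=> /minn_idPr ->.
  rewrite E0 -stat (split_int _ mX1) -(integral_cst P mDC); apply: leeD.
    apply: natintegral_le => //.
    - exact: (discrete_mfun_comp (fun y => minn (queue_sqr y) M) mX1).
    - exact: (discrete_mfun_comp queue_sqr mX1).
    - by move=> w _; rewrite geq_minl.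
  apply: natintegral_le => //.
  - exact: (discrete_mfun_comp (fun y => minn (queue_sqr y) M) mX1).
  - exact: (discrete_mfun_comp (fun=> M) mX1).
  - by move=> w _; rewrite geq_minr.
(* V is at most M on [D]; finiteness allows this term to be cancelled from [step]. *)
have fin0 : \int[P]_(w in X 0%N @^-1` D) (queue_sqr (X 0%N w))%:R%:E \is a fin_num.
  rewrite ge0_fin_numE; last by apply: integral_ge0 => w _; rewrite lee_fin.
  apply: (@le_lt_trans _ _ (\int[P]_(w in X 0%N @^-1` D) M%:R%:E)).
    apply: natintegral_le => //; first exact: (discrete_mfun_comp queue_sqr mX0).
    exact: (discrete_mfun_comp (fun=> M) mX0).
  by rewrite (integral_cst P mD) ltey_eq fin_numM// fin_num_measure.
rewrite -(leeD2lE _ _ fin0); apply: le_trans (leeD2r _ trunc) _.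
move: step; rewrite !ge0_integralD//; try exact: mint;
  try exact: (mint (fun y => (queue_sqr y)%:R)); try exact: (mint1 (fun y => (queue_sqr y)%:R));
  by move=> w _; rewrite lee_fin// second_order_ge0.
Qed.


Lemma integral_drift :
  \int[P]_w (2 * eps * (queue_total (X 0%N w))%:R)%:E <=
  \int[P]_w (second_order (X 0%N w))%:E.
Proof.
have e0 := eps_gt0.
have W20 x : (0 <= 2 * eps * (queue_total x)%:R)%R.
  by apply: mulr_ge0 => //; apply: mulr_ge0 => //; exact: ltW.
pose F M := X 0%N @^-1` [set x | (queue_sqr x <= M)%N].
have mF M : measurable (F M) by exact: mX0.
have FT : \bigcup_M F M = setT.
  by apply/seteqP; split => // w _; exists (queue_sqr (X 0%N w)) => //; rewrite /F/=.
have ndF : {homo F : a b / (a <= b)%N >-> (a <= b)%O}.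
  by move=> a b ab; apply/subsetPset => w /= wa; exact: leq_trans wa ab.
have := @ge0_nondecreasing_set_cvg_integral _ _ _ F
  (fun w => (2 * eps * (queue_total (X 0%N w))%:R)%:E) P ndF mF
  (fun M => @mint (fun y => 2 * eps * (queue_total y)%:R)%R (F M)) (fun M w _ => W20 (X 0%N w)).
rewrite FT => cv; rewrite -(cvg_lim _ cv)//; apply: lime_le; first by apply/cvg_ex; eexists; exact: cv.
near=> M; apply: le_trans (truncated_drift M) _.
apply: ge0_subset_integral => //.
by move=> w _; rewrite lee_fin second_order_ge0.
Unshelve. all: by end_near.
Qed.

Lemma second_order_bounded : exists B : R, forall x, (second_order x <= B)%R.
Proof.
exists (N%:R * m2 + ((2 * d)%:R + 2 * m1) * N%:R + N%:R)%R => x.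
have m13 := m1_lt; have m10 := m1_ge0; case/andP: q01 => q0 q1.
have S0 := total_service_ge0 x; have SN := total_service_le x.
have C0 := total_transfer_ge0 x; have CS := total_transfer_le x.
have CN : (total_transfer x <= N%:R)%R.
  by apply: le_trans CS (le_trans _ SN); rewrite ler_piMl//; lra.
rewrite /second_order lerD// ?lerD2l.
  by rewrite ler_wpM2l// addr_ge0// mulr_ge0.
by apply: le_trans SN; rewrite ler_piMl//; lra.
Qed.

Lemma integral_fin (h : state d n -> R) (B : R) : (forall x, (0 <= h x <= B)%R) ->
  \int[P]_w (h (X 0%N w))%:E \is a fin_num.
Proof.
move=> hB; rewrite ge0_fin_numE; last first.
  by apply: integral_ge0 => w _; rewrite lee_fin; case/andP: (hB (X 0%N w)).
apply: (@le_lt_trans _ _ (\int[P]_w B%:E)).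
  apply: ge0_le_integral => //.
  - by move=> w _; rewrite lee_fin; case/andP: (hB (X 0%N w)).
  - by move=> w _; rewrite lee_fin; case/andP: (hB (X 0%N w)).
rewrite (integral_cst P measurableT) [X in _ * X](_ : _ = 1) ?mule1 ?ltry//.
exact: probability_setT.
Qed.

Lemma integral_total_fin : \int[P]_w ((queue_total (X 0%N w))%:R : R)%:E \is a fin_num.
Proof.
have e0 := eps_gt0; have := integral_drift; have [B hB] := second_order_bounded.
have fins : \int[P]_w (second_order (X 0%N w))%:E \is a fin_num.
  by apply: (@integral_fin _ B) => x; rewrite second_order_ge0 hB.
have e20 : (0 < 2 * eps)%R by apply: mulr_gt0.
under eq_integral do rewrite EFinM.
rewrite (ge0_integralZl P measurableT (@mint (fun y => (queue_total y)%:R) setT)); last 2 first.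
- by move=> w _; rewrite lee_fin.
- by rewrite lee_fin ltW.
move=> le; rewrite ge0_fin_numE; last by apply: integral_ge0 => w _; rewrite lee_fin.
rewrite -(fineK fins) in le; move: le; case: (integral _ _ _) => [r _||]//; first by rewrite ltry.
by rewrite gt0_muley ?lte_fin// leye_eq.
Qed.

Let meanS := fine (\int[P]_w (total_service (X 0%N w))%:E).
Let meanC := fine (\int[P]_w (total_transfer (X 0%N w))%:E).

Lemma integral_total_service : \int[P]_w (total_service (X 0%N w))%:E = meanS%:E.
Proof.
rewrite fineK// (@integral_fin _ N%:R)// => x.
by rewrite total_service_ge0 total_service_le.
Qed.

Lemma integral_total_transfer : \int[P]_w (total_transfer (X 0%N w))%:E = meanC%:E.
Proof.
rewrite fineK// (@integral_fin _ N%:R)// => x.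
rewrite total_transfer_ge0/=; apply: le_trans (total_transfer_le x) _.
apply: le_trans (total_service_le x).
by rewrite ler_piMl ?total_service_ge0//; case/andP: q01 => q0 q1; lra.
Qed.

(** On each fiber, content after the step plus services equals content before plus arrivals plus
    transfers, in the mean. The two mean contents agree by stationarity and cancel because they are
    finite. *)
Lemma flow_balance : (meanS = N%:R * m1 + meanC)%R.
Proof.
have mW k (mXk : discrete_mfun (X k)) :
    measurable_fun setT (fun w => ((queue_total (X k w))%:R : R)%:E).
  exact: (@discrete_mfunW _ _ _ _ _ _ (fun y => ((queue_total y)%:R : R)%:E) _ mXk).
have : \int[P]_w ((queue_total (X 1%N w))%:R%:E + (total_service (X 0%N w))%:E) =
    \int[P]_w ((queue_total (X 0%N w))%:R%:E + (N%:R * m1 + total_transfer (X 0%N w))%:E).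
  rewrite -(preimage_setT (X 0%N)).
  apply: (@eq_integral_fibers _ _ _ P _ _ mX0).
  - by apply: emeasurable_funD; [exact: mW|exact: mint].
  - apply: emeasurable_funD; first exact: mW.
    exact: (@mint (fun y => N%:R * m1 + total_transfer y)%R).
  - by move=> w; rewrite -EFinD lee_fin addr_ge0// total_service_ge0.
  - move=> w; rewrite -EFinD lee_fin !addr_ge0// ?total_transfer_ge0//.
    by apply: mulr_ge0 => //; exact: m1_ge0.
  move=> x; have mx : measurable (X 0%N @^-1` [set x]) by exact: mX0.
  pose p := fine (P (X 0%N @^-1` [set x])).
  have cstc (c : R) : \int[P]_(w in X 0%N @^-1` [set x]) c%:E = (p * c)%:E.
    by rewrite (integral_cst P mx) EFinM muleC fineK ?fin_num_measure.
  have cstx (h : state d n -> R) : \int[P]_(w in X 0%N @^-1` [set x]) (h (X 0%N w))%:E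
      = (p * h x)%:E.
    by rewrite -cstc; apply: eq_integral => w; rewrite inE => /= ->.
  under [RHS]eq_integral do rewrite -EFinD.
  rewrite (cstx (fun y => (queue_total y)%:R + (N%:R * m1 + total_transfer y))%R).
  rewrite (ge0_integralD P mx _ (@mint1 (fun y => (queue_total y)%:R) _) _ (@mint total_service _));
    last 2 first.
  - by move=> w _; rewrite lee_fin.
  - by move=> w _; rewrite lee_fin total_service_ge0.
  rewrite cstx.
  have ms i : discrete_mfun (fun w => nat_of_bool (service alg U x i w)).
    exact: discrete_mfun_service.
  have mA i : discrete_mfun (inflow alg U route x i) by exact: (discrete_mfun_inflow hmodel).
  have mxi i : discrete_mfun (xi 0%N i) by exact: discrete_mfun_arrival.
  have Ei i : \int[P]_(w in X 0%N @^-1` [set x]) ((X 1%N w i)%:R : R)%:E + (p * service_rate R x i)%:E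
      = (p * ((x i)%:R + m1 + transfer_rate q x i))%:E.
    have mXi : discrete_mfun (fun w => X 1%N w i).
      exact: (discrete_mfun_comp (fun y : state d n => y i) mX1).
    rewrite -(integral_service hmodel x i) -natintegralD//.
    transitivity (\int[P]_(w in X 0%N @^-1` [set x])
        ((x i + xi 0%N i w + inflow alg U route x i w)%N%:R : R)%:E).
      apply: eq_integral => w; rewrite inE => wx; congr (_%:R%:E).
      by rewrite (next_initial hmodel wx); exact: next_stateE.
    rewrite natintegralD//; last first.
      by discrete_mfun_linear.
    rewrite natintegralD//; last by discrete_mfun_linear.
    rewrite (integral_inflow hmodel) (integral_arrival hmodel x i (h := fun m => (m%:R%R)%:E)).
      rewrite mean_mu cstc -EFinM -!EFinD.
      by congr EFin; rewrite !mulrDr.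
    by move=> m; rewrite lee_fin.
  have -> : \int[P]_(w in X 0%N @^-1` [set x]) ((queue_total (X 1%N w))%:R%R : R)%:E
      = \sum_i \int[P]_(w in X 0%N @^-1` [set x]) ((X 1%N w i)%N%:R%R)%:E.
    apply: (natintegral_sum P mx predT) => i.
    exact: (discrete_mfun_comp (fun y : state d n => y i) mX1).
  rewrite /total_service big_distrr/= -sumEFin -big_split/= (eq_bigr _ (fun i _ => Ei i)).
  rewrite sumEFin -big_distrr/= !big_split/= /queue_total natr_sum sumr_const.
  by rewrite mulr_natl addrA.
have nnW y : 0 <= ((queue_total y)%:R : R)%:E by rewrite lee_fin.
have := eq_law_integral mX1 mX0 (hstat 1%N) setT nnW; rewrite !preimage_setT => statW.
rewrite (ge0_integralD P measurableT _ (mW 1%N mX1) _ (@mint total_service _)); last 2 first.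
- by move=> w _; rewrite lee_fin.
- by move=> w _; rewrite lee_fin total_service_ge0.
rewrite (ge0_integralD P measurableT _ (mW 0%N mX0) _
  (@mint (fun y => N%:R * m1 + total_transfer y)%R _)); last 2 first.
- by move=> w _; rewrite lee_fin.
- by move=> w _; rewrite lee_fin addr_ge0 ?total_transfer_ge0//; apply: mulr_ge0 => //; exact: m1_ge0.
under [X in _ = _ + X -> _]eq_integral do rewrite EFinD.
rewrite (ge0_integralD P measurableT _ (measurable_cst _) _ (@mint total_transfer _)); last 2 first.
- by move=> w _; rewrite lee_fin; apply: mulr_ge0 => //; exact: m1_ge0.
- by move=> w _; rewrite lee_fin total_transfer_ge0.
rewrite (integral_cst P measurableT) [X in (_ * _)%:E * X](_ : _ = 1) ?mule1; last exact: probability_setT.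
rewrite statW integral_total_service integral_total_transfer -(fineK integral_total_fin) -!EFinD.
by case=> /addrI.
Qed.

Lemma mean_queue_total :
  (2 * eps)%:E * \int[P]_w ((queue_total (X 0%N w))%:R : R)%:E <=
  (N%:R * (m2 + 2 * d%:R * (1 - q) * lambda + lambda - 2 * lambda ^+ 2 * q ^+ 2))%:E.
Proof.
have e0 := eps_gt0; have m10 := m1_ge0; have m13 := m1_lt; case/andP: q01 => q0 q1.
have -> : (2 * eps)%:E * \int[P]_w ((queue_total (X 0%N w))%:R : R)%:E
    = \int[P]_w (2 * eps * (queue_total (X 0%N w))%:R)%:E.
  under [RHS]eq_integral do rewrite EFinM.
  rewrite (ge0_integralZl P measurableT (@mint (fun y => (queue_total y)%:R) setT))//.
  by rewrite lee_fin ltW// mulr_gt0.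
apply: le_trans integral_drift _.
have C0 : (0 <= (2 * d)%:R + 2 * m1)%R by rewrite addr_ge0// mulr_ge0.
have S0 : (0 <= 1 - 2 * m1)%R by lra.
have -> : \int[P]_w (second_order (X 0%N w))%:E =
    (N%:R * m2 + ((2 * d)%:R + 2 * m1) * meanC + (1 - 2 * m1) * meanS)%:E.
  have intD h1 h2 : (forall x, 0 <= h1 x)%R -> (forall x, 0 <= h2 x)%R ->
      \int[P]_w (h1 (X 0%N w) + h2 (X 0%N w))%:E
      = \int[P]_w (h1 (X 0%N w))%:E + \int[P]_w (h2 (X 0%N w))%:E.
    move=> h10 h20; under eq_integral do rewrite EFinD.
    by rewrite (ge0_integralD P measurableT _ (@mint h1 _) _ (@mint h2 _))//;
      move=> w _; rewrite lee_fin.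
  have intZ c h : (0 <= c)%R -> (forall x, 0 <= h x)%R ->
      \int[P]_w (c * h (X 0%N w))%:E = c%:E * \int[P]_w (h (X 0%N w))%:E.
    move=> c0 h0; under eq_integral do rewrite EFinM.
    by rewrite (ge0_integralZl P measurableT (@mint h setT))// => w _; rewrite lee_fin.
  have intc c : \int[P]_w c%:E = c%:E.
    rewrite (integral_cst P measurableT) [X in _ * X](_ : _ = 1) ?mule1//.
    exact: probability_setT.
  have nn1 x : (0 <= N%:R * m2)%R by rewrite mulr_ge0// m2_ge0.
  have nn2 x : (0 <= ((2 * d)%:R + 2 * m1) * total_transfer x)%R.
    by rewrite mulr_ge0// total_transfer_ge0.
  have nn3 x : (0 <= (1 - 2 * m1) * total_service x)%R by rewrite mulr_ge0// total_service_ge0.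
  rewrite (intD (fun x => N%:R * m2 + ((2 * d)%:R + 2 * m1) * total_transfer x)%R _ _ nn3); last first.
    by move=> x; exact: (addr_ge0 (nn1 x) (nn2 x)).
  rewrite (intD _ _ nn1 nn2) intc (intZ _ _ C0 total_transfer_ge0) (intZ _ _ S0 total_service_ge0).
  by rewrite integral_total_service integral_total_transfer -!EFinM -!EFinD.
have flow := flow_balance.
have meanCS : (meanC <= (1 - q) * meanS)%R.
  rewrite -lee_fin EFinM -integral_total_transfer -integral_total_service.
  rewrite -(ge0_integralZl P measurableT (@mint total_service setT)); last 2 first.
  - by move=> w _; rewrite lee_fin total_service_ge0.
  - by rewrite lee_fin; lra.
  apply: ge0_le_integral => //.
  - by move=> w _; rewrite lee_fin total_transfer_ge0.
  - exact: (@mint (fun y => (1 - q) * total_service y)%R).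
  - by move=> w _; rewrite lee_fin total_transfer_le.
(* Flow balance with meanC <= (1 - q) meanS leaves q meanS <= N m1 = N lambda q. *)
have S1 : (meanS <= N%:R * lambda)%R.
  rewrite -(ler_pM2l q0); move: meanCS; rewrite flow /m1; lra.
rewrite lee_fin natrM; have C1 : (meanC = meanS - N%:R * m1)%R by rewrite flow; lra.
have C2 : (meanC <= (1 - q) * (N%:R * lambda))%R.
  by apply: le_trans meanCS _; rewrite ler_wpM2l//; lra.
have d0 : (0 <= 2 * d%:R :> R)%R by rewrite mulr_ge0.
have := ler_wpM2l d0 C2.
(* By flow balance 2 m1 meanC + (1 - 2 m1) meanS = meanS - 2 N m1 ^ 2, the origin of the term - 2
   lambda ^ 2 q ^ 2. *)
have -> : (2 * m1 = 2 * (lambda * q))%R by [].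
rewrite C1 /m1; lra.
Qed.

End StationaryDrift.

(** * Uniqueness of the invariant law *)

Section InvariantLaw.
Variables (R : realType) (K : choiceType).
Local Open Scope ereal_scope.

Lemma esum_ge1 (a : K -> \bar R) x : (forall y, 0 <= a y) -> a x <= \esum_(y in setT) a y.
Proof.
move=> a0; apply: esum_ge; exists [set x]; first by split.
by rewrite fsbig_set1.
Qed.

(** The differences are nonnegative and, the common total being finite, sum to zero. *)
Lemma esum_eq_le (a b : K -> R) : (forall y, 0 <= a y)%R -> (forall y, a y <= b y)%R ->
  \esum_(y in setT) (a y)%:E = \esum_(y in setT) (b y)%:E ->
  \esum_(y in setT) (b y)%:E < +oo -> forall y, a y = b y.
Proof.
move=> a0 ab e fin y; have ba0 z : 0 <= (b z - a z)%:E by rewrite lee_fin subr_ge0.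
have bE : \esum_(y in setT) (b y)%:E
    = \esum_(y in setT) (a y)%:E + \esum_(y in setT) (b y - a y)%:E.
  rewrite -esumD => [|z _|z _]; rewrite ?lee_fin ?subr_ge0//.
  by apply: eq_esum => z _; rewrite -EFinD addrC subrK.
have afin : \esum_(y in setT) (a y)%:E \is a fin_num.
  by rewrite ge0_fin_numE ?e//; apply: esum_ge0 => z _; rewrite lee_fin (le_trans (a0 z)).
have : \esum_(y in setT) (b y - a y)%:E = 0.
  move: bE; rewrite -e -(fineK afin); case: (\esum_(y in setT) (b y - a y)%:E) => // r.
  by rewrite -EFinD => -[] /eqP; rewrite addrC -subr_eq subrr => /eqP <-.
move=> sum0; have := esum_ge1 y ba0; rewrite sum0 lee_fin subr_le0 => ba.
by apply/eqP; rewrite eq_le ab ba.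
Qed.

(** The inequality from left to right, applied to the inverse of [c], yields the converse. *)
Lemma ge0_esumZl (c : R) (a : K -> \bar R) : (0 <= c)%R -> (forall x, 0 <= a x) ->
  \esum_(x in setT) (c%:E * a x) = c%:E * \esum_(x in setT) a x.
Proof.
move=> c0 a0; have le (e : R) (f : K -> \bar R) : (0 <= e)%R -> (forall x, 0 <= f x) ->
    \esum_(x in setT) (e%:E * f x) <= e%:E * \esum_(x in setT) f x.
  move=> e0 f0; apply: ge_ereal_sup => _ [S Sfin <-]; rewrite -ge0_mule_fsumr//.
  by apply: lee_wpmul2l; rewrite ?lee_fin//; apply: esum_ge; exists S.
apply/eqP; rewrite eq_le le//=; have [<-|cn0] := eqVneq 0%R c.
  by rewrite mul0e esum_ge0// => x _; rewrite mule_ge0.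
have {cn0}c0 : (0 < c)%R by rewrite lt_neqAle cn0.
have ca0 x : 0 <= c%:E * a x by rewrite mule_ge0// lee_fin ltW.
rewrite -lee_pdivlMl//; apply: le_trans (le _ _ _ ca0); last by rewrite invr_ge0 ltW.
apply: le_esum => x _; rewrite muleA -EFinM mulVf ?mul1e//.
by rewrite gt_eqF.
Qed.

Lemma esum_exchange (a : K -> K -> \bar R) : (forall x y, 0 <= a x y) ->
  \esum_(y in setT) \esum_(x in setT) a x y = \esum_(x in setT) \esum_(y in setT) a x y.
Proof.
move=> a0; rewrite !esum_esum//.
rewrite (@reindex_esum _ _ _ (setT `*`` (fun=> setT)) (setT `*`` (fun=> setT))
  (fun z : K * K => (z.2, z.1)))//.
split => [[x y] []|[x y] [x' y'] _ _ [-> ->]|[x y] _] //=.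
by exists (y, x).
Qed.

Variables (k : K -> K -> R) (size : K -> nat) (z0 : K).
Hypothesis k0 : forall x y, (0 <= k x y)%R.
Hypothesis size0 : forall x, size x = 0%N -> x = z0.
Hypothesis size_decr : forall x, (0 < size x)%N -> exists2 y, (size y < size x)%N & (0 < k x y)%R.

Definition kernel_invariant (p : K -> R) :=
  (forall x, 0 <= p x)%R /\ forall y, \esum_(x in setT) (p x * k x y)%:E = (p y)%:E.

(** Zeros propagate backwards along transitions: p x k(x, y) <= p y = 0 with k(x, y) > 0. Induction
    on the size reaches every state from [z0]. *)
Lemma invariant_eq0 p : kernel_invariant p -> p z0 = 0%R -> forall x, p x = 0%R.
Proof.
move=> [p0 inv] pz x; have [m] := ubnP (size x); elim: m x => // m IH x xm.
have [/size0 ->//|sx] := posnP (size x).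
have [y yx kxy] := size_decr sx.
have py : p y = 0%R by apply: IH; rewrite (leq_trans yx).
have : (p x * k x y)%:E <= \esum_(z in setT) (p z * k z y)%:E.
  by apply: (@esum_ge1 (fun z => (p z * k z y)%:E)) => z; rewrite lee_fin mulr_ge0.
rewrite inv py lee_fin pmulr_lle0// => px.
by apply/eqP; rewrite eq_le px p0.
Qed.

Hypothesis k1 : forall x, \esum_(y in setT) (k x y)%:E = 1.

(** One step of the kernel takes the minimum below both laws, hence below itself, while preserving
    its total mass; as the mass is finite, equality holds pointwise. *)
Lemma invariant_min p p' : kernel_invariant p -> kernel_invariant p' ->
  \esum_(x in setT) (p x)%:E < +oo ->
  kernel_invariant (fun x => Num.min (p x) (p' x)).
Proof.
move=> [p0 inv] [p0' inv'] fin; pose r x := Num.min (p x) (p' x).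
have r0 x : (0 <= r x)%R by rewrite /r le_min p0 p0'.
have rp x : (r x <= p x)%R by rewrite /r ge_min lexx.
have rp' x : (r x <= p' x)%R by rewrite /r ge_min lexx orbT.
split=> //; pose s y := \esum_(x in setT) (r x * k x y)%:E.
have s0 y : 0 <= s y by apply: esum_ge0 => x _; rewrite lee_fin mulr_ge0.
have sr y : s y <= (r y)%:E.
  rewrite /r EFin_min le_min -inv -inv'; apply/andP.
  by split; apply: le_esum => x _; rewrite lee_fin ler_wpM2r.
have sfin y : s y \is a fin_num by rewrite ge0_fin_numE// (le_lt_trans (sr y)) ?ltry.
have sum : \esum_(y in setT) (fine (s y))%:E = \esum_(y in setT) (r y)%:E.
  under eq_esum do rewrite fineK//.
  rewrite /s esum_exchange; last by move=> x y; rewrite lee_fin mulr_ge0.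
  apply: eq_esum => x _; under eq_esum do rewrite EFinM.
  by rewrite ge0_esumZl ?k1 ?mule1// => y; rewrite lee_fin.
move=> y; rewrite -/(s y) -(fineK (sfin y)); congr EFin; move: y.
apply: (esum_eq_le _ _ sum).
- by move=> y; rewrite fine_ge0.
- by move=> y; rewrite -lee_fin fineK.
- by apply: le_lt_trans fin; apply: le_esum => x _; rewrite lee_fin.
Qed.

Lemma invariant_unique p p' : kernel_invariant p -> kernel_invariant p' ->
  \esum_(x in setT) (p x)%:E = 1 -> \esum_(x in setT) (p' x)%:E = 1 ->
  forall x, p x = p' x.
Proof.
(* This choice makes p minus the minimum vanish at [z0], hence everywhere; then p <= p', and equal
   masses conclude. *)
wlog pz : p p' / (p z0 <= p' z0)%R => [hw|] ip ip' p1 p1'.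
  have [le|/ltW le] := leP (p z0) (p' z0); first exact: hw.
  by move=> x; apply/esym/hw.
have pfin : \esum_(x in setT) (p x)%:E < +oo by rewrite p1 ltry.
have im := invariant_min ip ip' pfin.
have [p0 inv] := ip; have [p0' _] := ip'; have [m0 minv] := im.
pose m x := Num.min (p x) (p' x).
have mp x : (m x <= p x)%R by rewrite /m ge_min lexx.
have id : kernel_invariant (fun x => p x - m x)%R.
  split=> [x|y]; first by rewrite subr_ge0.
  have m0k x : 0 <= (m x * k x y)%:E by rewrite lee_fin; apply: mulr_ge0 => //; exact: m0.
  have d0k x : 0 <= ((p x - m x) * k x y)%:E by rewrite lee_fin mulr_ge0// subr_ge0.
  have := inv y; have -> : \esum_(x in setT) (p x * k x y)%:E
      = \esum_(x in setT) (m x * k x y)%:E + \esum_(x in setT) ((p x - m x) * k x y)%:E.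
    by rewrite -esumD//; apply: eq_esum => x _; rewrite -EFinD -mulrDl addrC subrK.
  rewrite minv; case: (\esum_(x in setT) ((p x - m x) * k x y)%:E) => // r.
  by rewrite -EFinD => -[<-]; rewrite addrC addKr.
have dz : (p z0 - m z0 = 0)%R by rewrite /m (min_idPl pz) subrr.
have le x : (p x <= p' x)%R.
  have /eqP := invariant_eq0 id dz x; rewrite subr_eq0 => /eqP ->.
  by rewrite /m ge_min lexx orbT.
by apply: (esum_eq_le p0 le); rewrite ?p1 ?p1' ?ltry.
Qed.

End InvariantLaw.

(** * Translation invariance of the stationary law *)

Section Driver.
Variables (R : realType) (d n : nat) (alg : algorithm).
Implicit Types (x y : state d n) (i j s : torus d n).

Definition driver : Type :=
  ((torus d n -> nat) * (torus d n -> R) * (torus d n -> option (torus d n)))%type.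

HB.instance Definition _ := Pointed.on driver.

Definition driver_rect (A : torus d n -> set nat) (B : torus d n -> set R)
    (C : torus d n -> set (option (torus d n))) : set driver :=
  [set v | forall i, [/\ A i (v.1.1 i), B i (v.1.2 i) & C i (v.2 i)]].

(** An intersection-closed family generating the sigma-algebra used on drivers; independence and
    laws are known directly on these sets. *)
Definition driver_rects : set (set driver) :=
  [set D | exists A B C, (forall i, measurable (B i)) /\ D = driver_rect A B C].

Lemma driver_rects_setI : setI_closed driver_rects.
Proof.
move=> _ _ [A [B [C [mB ->]]]] [A' [B' [C' [mB' ->]]]].
exists (fun i => A i `&` A' i), (fun i => B i `&` B' i), (fun i => C i `&` C' i).
split; first by move=> i; exact: measurableI.
apply/seteqP; split=> v; first by move=> [h h'] i; have [? ? ?] := h i; have [? ? ?] := h' i.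
by move=> h; split=> i; have [[? ?] [? ?] [? ?]] := h i.
Qed.

Let mdriver := g_sigma_algebraType driver_rects.

Definition next_driver x (v : driver) : state d n := next_state alg x v.1.1 v.1.2 v.2.

(** The clocks enter only through the finitely many service indicators, so the next state is a
    function of a measurable variable [z] with countably many values. *)
Lemma measurable_next_driver x y : <<s driver_rects >> [set v | next_driver x v = y].
Proof.
have mrect A B C : (forall i, measurable (B i)) ->
    measurable (driver_rect A B C : set mdriver).
  by move=> mB; apply: sub_sigma_algebra; exists A, B, C.
have ma i : discrete_mfun (fun v : mdriver => v.1.1 i).
  move=> A; rewrite (_ : _ @^-1` _ =
    driver_rect (fun j => if j == i then A else setT) (fun=> setT) (fun=> setT)).
    by apply: mrect.
  apply/seteqP; split=> v /=; first by move=> vA j; split=> //; case: eqP => // ->.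
  by move=> /(_ i) []; rewrite eqxx.
have mr i : discrete_mfun (fun v : mdriver => v.2 i).
  move=> A; rewrite (_ : _ @^-1` _ =
    driver_rect (fun=> setT) (fun=> setT) (fun j => if j == i then A else setT)).
    by apply: mrect.
  apply/seteqP; split=> v /=; first by move=> vA j; split=> //; case: eqP => // ->.
  by move=> /(_ i) [_ _]; rewrite eqxx.
have mu i : measurable_fun setT (fun v : mdriver => v.1.2 i).
  move=> _ A mA; rewrite setTI (_ : _ @^-1` _ =
    driver_rect (fun=> setT) (fun j => if j == i then A else setT) (fun=> setT)).
    by apply: mrect => j; case: eqP.
  apply/seteqP; split=> v /=; first by move=> vA j; split=> //; case: eqP => // ->.
  by move=> /(_ i) [_]; rewrite eqxx.
pose h (z : {ffun torus d n -> nat} * {ffun torus d n -> bool}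
    * {ffun torus d n -> option (torus d n)}) : state d n :=
  [ffun i => (x i + z.1.1 i + \sum_(j in nbhd i :\ i) (z.2 j == Some i) * z.1.2 j - z.1.2 i)%N].
pose z (v : mdriver) := ([ffun i => v.1.1 i], [ffun i => served alg x v.1.2 i], [ffun i => v.2 i]).
have mz : discrete_mfun z.
  apply: discrete_mfun_pair; last exact: discrete_mfun_ffun.
  apply: discrete_mfun_pair; first exact: discrete_mfun_ffun.
  apply: discrete_mfun_ffun => i; apply: discrete_mfun_bool.
  exact: (@measurable_served _ mdriver _ _ _ alg x (fun v => v.1.2)).
have := discrete_mfun_comp h mz [set y].
congr (measurable _); apply/seteqP; split=> v /=; rewrite /h /z /next_driver /next_state /=.
  move=> <-; apply/ffunP => i; rewrite !ffunE; congr (_ + _ - _)%N.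
  by apply: eq_bigr => j _; rewrite !ffunE.
move=> <-; apply/ffunP => i; rewrite !ffunE; congr (_ + _ - _)%N.
by apply: eq_bigr => j _; rewrite !ffunE.
Qed.

(* The model prescribes the law of a route on [None] and on adjacent nodes only.
   Sending every other destination to [None] makes the law translation
   invariant and does not change [next_state]. *)
Definition eff_route i (o : option (torus d n)) : option (torus d n) :=
  if o is Some j then if torus_adj i j then Some j else None else None.

Lemma eff_route_adj i j o : torus_adj i j -> (eff_route i o == Some j) = (o == Some j).
Proof.
move=> ij; case: o => //= k; case: ifPn => // ik; apply/esym/negbTE.
by apply: contra ik => /eqP[->].
Qed.

Lemma next_state_eff x a (u : torus d n -> R) r :
  next_state alg x a u (fun j => eff_route j (r j)) = next_state alg x a u r.
Proof.
apply/ffunP => i; rewrite !ffunE; congr (_ + _ - _)%N.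
apply: eq_bigr => j /nbhdD1_adj; rewrite torus_adj_sym => ji.
by rewrite eff_route_adj.
Qed.

Lemma shift_stateK s : cancel (@shift_state d n s) (shift_state (- s)).
Proof. by move=> x; apply/ffunP => i; rewrite !ffunE subrK. Qed.

Lemma shift_stateVK s : cancel (@shift_state d n (- s)) (shift_state s).
Proof. by move=> x; apply/ffunP => i; rewrite !ffunE addrK. Qed.

Definition shift_driver s (v : driver) : driver :=
  (fun i => v.1.1 (i + s), fun i => v.1.2 (i + s), fun i => omap (fun j => j - s) (v.2 (i + s))).

Lemma next_driver_shift s x v :
  next_driver (shift_state s x) (shift_driver s v) = shift_state s (next_driver x v).
Proof. exact: next_state_shift. Qed.

End Driver.

Section Symmetry.
Variables (R : realType) (d n : nat) (q : R) (alg : algorithm) (mu : probability nat R).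
Variables (dT : measure_display) (T : measurableType dT) (P : probability T R).
Variables (X : nat -> T -> state d n) (xi : nat -> torus d n -> {RV P >-> nat}).
Variables (U : nat -> torus d n -> {RV P >-> R}).
Variable route : nat -> torus d n -> T -> option (torus d n).
Hypothesis hmodel : multihop X xi U route alg q mu.
Implicit Types (x y : state d n) (i j s : torus d n).
Local Open Scope ereal_scope.

Definition drive (w : T) : driver R d n :=
  (xi 0%N ^~ w, U 0%N ^~ w, fun j => eff_route j (route 0%N j w)).

Lemma measurable_route_event i (V : set (option (torus d n))) :
  measurable (route 0%N i @^-1` V).
Proof. exact: (route_measurable hmodel). Qed.

(** On [Some j] both laws charge (1 - q) / (2 d) or nothing, according to an adjacency that
    translations preserve; the mass at [None] is then fixed as the complement. *)
Lemma eff_route_law s i (V : set (option (torus d n))) :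
  P [set w | V (eff_route i (route 0%N i w))] =
  P [set w | V (omap (fun j => j - s)%R (eff_route (i + s)%R (route 0%N (i + s)%R w)))].
Proof.
pose f w := eff_route i (route 0%N i w).
pose g w := omap (fun j => j - s)%R (eff_route (i + s)%R (route 0%N (i + s)%R w)).
have mf : discrete_mfun f by move=> A; exact: (measurable_route_event i (eff_route i @^-1` A)).
have mg : discrete_mfun g.
  move=> A; exact: (measurable_route_event (i + s)%R
    ((fun o => omap (fun j => j - s)%R (eff_route (i + s)%R o)) @^-1` A)).
have fg j : P (f @^-1` [set Some j]) = P (g @^-1` [set Some j]).
  have gE w : (g w == Some j) = (eff_route (i + s)%R (route 0%N (i + s)%R w) == Some (j + s)%R).
    rewrite /g; case: eff_route => //= k.
    by rewrite !(inj_eq Some_inj) subr_eq.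
  have [ij|ij] := boolP (torus_adj i j).
    rewrite (_ : f @^-1` _ = route 0%N i @^-1` [set Some j]); last first.
      by apply/seteqP; split=> w /= h; apply/eqP; move/eqP: h; rewrite /f eff_route_adj.
    rewrite (_ : g @^-1` _ = route 0%N (i + s)%R @^-1` [set Some (j + s)%R]); last first.
      by apply/seteqP; split=> w /= h; apply/eqP; move/eqP: h; rewrite gE eff_route_adj ?torus_adjD.
    by rewrite !(routing_law hmodel)// torus_adjD.
  have noadj k l o : ~~ torus_adj k l -> eff_route k o <> Some l :> option (torus d n).
    by case: o => //= m kl; case: ifPn => // km [ml]; rewrite -ml km in kl.
  rewrite (_ : f @^-1` _ = set0); last by rewrite -subset0 => w /= /noadj; apply.
  rewrite (_ : g @^-1` _ = set0)//.
  rewrite -subset0 => w /= /eqP; rewrite gE => /eqP /noadj; apply.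
  by rewrite torus_adjD.
apply: (eq_law_measure mf mg) => -[j|]; first exact: fg.
have : P (f @^-1` (~` [set None])) = P (g @^-1` (~` [set None])).
  by rewrite (measure_fibers _ mf) (measure_fibers _ mg); apply: eq_esum => -[j|] //= _; exact: fg.
have pC (h : T -> option (torus d n)) : discrete_mfun h ->
    P (h @^-1` [set None]) = 1 - P (h @^-1` (~` [set None])).
  move=> mh; rewrite -probability_setC; last exact: mh.
  by congr (P _); exact/esym/setCK.
by move=> e; apply: etrans (pC f mf) _; rewrite e; exact/esym/pC.
Qed.

Lemma drive_rect s Y A B C : (forall i, measurable (B i)) ->
  P (X 0%N @^-1` Y `&` drive @^-1` driver_rect A B C) =
  P (X 0%N @^-1` Y) * P ((shift_driver s \o drive) @^-1` driver_rect A B C).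
Proof.
move=> mB.
have sbij : {on [pred _ | true], bijective (fun i : torus d n => i + s)%R}.
  by apply: onW_bij; exists (fun i => i - s)%R => i; rewrite ?addrK ?subrK.
have -> : X 0%N @^-1` Y `&` drive @^-1` driver_rect A B C =
    sources_event X xi route Y A (fun i => [set o | C i (eff_route i o)])
    `&` \bigcap_i (U 0%N i @^-1` B i).
  apply/seteqP; split=> w.
    by move=> [Yw h]; split; [split; [split=> //|]|]; move=> i _; have [] := h i.
  move=> [[[Yw hA] hC] hB]; split=> // i.
  by split; [exact: hA|exact: hB|exact: hC].
have -> : (shift_driver s \o drive) @^-1` driver_rect A B C =
    sources_event X xi route setT (fun i => A (i - s)%R)
      (fun i => [set o | C (i - s)%R (omap (fun j => j - s)%R (eff_route i o))])
    `&` \bigcap_i (U 0%N i @^-1` B (i - s)%R).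
  apply/seteqP; split=> w.
    move=> h; split; [split; [split=> //|]|]; move=> i _; have [] := h (i - s)%R;
    by rewrite /= subrK.
  move=> [[[Yw hA] hC] hB] i.
  have := hA (i + s)%R Logic.I; have := hB (i + s)%R Logic.I; have := hC (i + s)%R Logic.I.
  by rewrite /= !addrK; split.
rewrite !(sources_rectangle hmodel)// preimage_setT probability_setT mul1e -muleA.
congr (_ * (_ * _ * _)).
- by rewrite [RHS](reindex _ sbij); apply: eq_bigr => i _; rewrite addrK.
- rewrite [RHS](reindex _ sbij); apply: eq_bigr => i _; rewrite addrK.
  exact: eff_route_law.
- by rewrite [RHS](reindex _ sbij); apply: eq_bigr => i _; rewrite addrK.
Qed.

(** [Y = setT] says that the driver and its translate have the same law; a general [Y] adds
    independence from the initial state. *)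
Lemma drive_indep s (Y : set (state d n)) (D : set (driver R d n)) :
  <<s @driver_rects R d n >> D ->
  [/\ measurable (drive @^-1` D), measurable ((shift_driver s \o drive) @^-1` D) &
      P (X 0%N @^-1` Y `&` drive @^-1` D) =
      P (X 0%N @^-1` Y) * P ((shift_driver s \o drive) @^-1` D)].
Proof.
have mr i : discrete_mfun (fun w => eff_route i (route 0%N i w)).
  by move=> A; exact: (measurable_route_event i (eff_route i @^-1` A)).
have mrect (s' : torus d n) A B C : (forall i, measurable (B i)) ->
    measurable ((shift_driver s' \o drive) @^-1` driver_rect A B C).
  move=> mB; rewrite (_ : _ @^-1` _ = \bigcap_(i in [set: torus d n])
    (xi 0%N (i + s')%R @^-1` A i `&` U 0%N (i + s')%R @^-1` B i `&`
     (fun w => omap (fun j => j - s')%R (eff_route (i + s')%R (route 0%N (i + s')%R w))) @^-1` C i)).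
    apply: fin_bigcap_measurable => // i _; apply: measurableI; first apply: measurableI.
    - exact: discrete_mfun_arrival.
    - by rewrite -[_ @^-1` _]setTI; exact: measurable_funP.
    - exact: (mr (i + s')%R (omap (fun j => j - s')%R @^-1` C i)).
  apply/seteqP; split=> w h; first by move=> i _; have [] := h i.
  by move=> i; have [[]] := h i Logic.I.
apply: dynkin_indep => //.
- exact: driver_rects_setI.
- exact: (initial_measurable hmodel).
- move=> _ [A [B [C [mB ->]]]]; have := mrect 0%R A B C mB; congr measurable.
  apply/seteqP; split=> w h i; have := h i; rewrite /= addr0; case: eff_route => //= j;
    by rewrite subr0.
- by move=> _ [A [B [C [mB ->]]]]; exact: mrect.
- by move=> _ [A [B [C [mB ->]]]]; exact: drive_rect.
Qed.

End Symmetry.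

(** * Transition kernel, reachability and symmetry of the stationary law *)

Section Kernel.
Variables (R : realType) (d n : nat) (q : R) (alg : algorithm) (mu : probability nat R).
Hypothesis q01 : 0 < q < 1.
Variables (dT : measure_display) (T : measurableType dT) (P : probability T R).
Variables (X : nat -> T -> state d n) (xi : nat -> torus d n -> {RV P >-> nat}).
Variables (U : nat -> torus d n -> {RV P >-> R}).
Variable route : nat -> torus d n -> T -> option (torus d n).
Hypothesis hmodel : multihop X xi U route alg q mu.
Implicit Types (x y : state d n) (i j s : torus d n).
Local Open Scope ereal_scope.

Let next x (w : T) : state d n := next_driver alg x (drive xi U route w).
Definition kernel x y : R := fine (P [set w | next x w = y]).

Lemma discrete_mfun_next x : discrete_mfun (next x).
Proof.
apply: discrete_mfunP => y.
by have [] := drive_indep hmodel 0%R setT (@measurable_next_driver R d n alg x y).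
Qed.

Let mnext x y : measurable [set w | next x w = y].
Proof. exact: (discrete_mfun_next x [set y]). Qed.

Lemma kernelE x y : P [set w | next x w = y] = (kernel x y)%:E.
Proof. by rewrite fineK// fin_num_measure. Qed.

Lemma kernel_ge0 x y : (0 <= kernel x y)%R.
Proof. exact: fine_ge0. Qed.

Lemma kernel_sum1 x : \esum_(y in setT) (kernel x y)%:E = 1.
Proof.
have -> : 1 = P (next x @^-1` setT) by rewrite preimage_setT probability_setT.
apply/esym; apply: etrans (measure_fibers P (discrete_mfun_next x) setT) _.
by apply: eq_esum => y _; exact: kernelE.
Qed.

Lemma next_stepE w : X 1%N w = next (X 0%N w) w.
Proof. by rewrite (evolution hmodel) -next_state_eff. Qed.

Lemma setI_step x y : X 0%N @^-1` [set x] `&` X 1%N @^-1` [set y] =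
  X 0%N @^-1` [set x] `&` [set w | next x w = y].
Proof.
by apply/seteqP; split=> w /= [wx]; rewrite next_stepE wx => wy; split.
Qed.

(** Measurability at time 1 is not a field of [multihop]: it is derived by splitting over the
    countably many initial states. *)
Lemma discrete_mfun_step : discrete_mfun (X 1%N).
Proof.
apply: discrete_mfunP => y.
have -> : X 1%N @^-1` [set y] = \bigcup_x (X 0%N @^-1` [set x] `&` [set w | next x w = y]).
  apply/seteqP; split=> [w wy|w [x _]].
    by exists (X 0%N w) => //; rewrite -setI_step.
  by rewrite -setI_step => -[].
apply: countable_bigcupT_measurable => [|x]; first exact: countableP.
by apply: measurableI => //; exact: (initial_measurable hmodel).
Qed.

Lemma transition_law x y :
  P (X 0%N @^-1` [set x] `&` X 1%N @^-1` [set y]) =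
  P (X 0%N @^-1` [set x]) * (kernel x y)%:E.
Proof.
rewrite setI_step.
(* Both instances have the same last factor; the one with [setT] identifies it as the kernel. *)
have [_ _ h] := drive_indep hmodel 0%R [set x] (@measurable_next_driver R d n alg x y).
have [_ _ h'] := drive_indep hmodel 0%R setT (@measurable_next_driver R d n alg x y).
apply: etrans h _; congr (_ * _); rewrite -kernelE.
by move: h'; rewrite preimage_setT setTI probability_setT mul1e => <-.
Qed.

(** The translated driver has the law of the original one and carries the translated state to the
    translated successor. *)
Lemma kernel_shift s x y : kernel (shift_state s x) (shift_state s y) = kernel x y.
Proof.
have [_ _] := drive_indep hmodel s setT
  (@measurable_next_driver R d n alg (shift_state s x) (shift_state s y)).
rewrite preimage_setT setTI probability_setT mul1e /kernel => h.
congr fine; apply: etrans h _; congr (P _).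
apply/seteqP; split=> w /=; rewrite next_driver_shift; last by rewrite /next => ->.
by move/(can_inj (shift_stateK s)).
Qed.

Hypothesis hstat : stationary P X.
Definition initial_law x : R := fine (P (X 0%N @^-1` [set x])).

Lemma initial_lawE x : P (X 0%N @^-1` [set x]) = (initial_law x)%:E.
Proof. by rewrite fineK// fin_num_measure//; exact: (initial_measurable hmodel). Qed.

Lemma initial_law_sum1 : \esum_(x in setT) (initial_law x)%:E = 1.
Proof.
have -> : 1 = P (X 0%N @^-1` setT) by rewrite preimage_setT probability_setT.
apply/esym; apply: etrans (measure_fibers P (discrete_mfun_initial hmodel) setT) _.
by apply: eq_esum => x _; exact: initial_lawE.
Qed.

Lemma initial_law_invariant : kernel_invariant kernel initial_law.
Proof.
split=> [x|y]; first exact: fine_ge0.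
rewrite -initial_lawE -(hstat 1%N).
rewrite (measure_setI_fibers P (discrete_mfun_initial hmodel)); last exact: discrete_mfun_step.
apply: eq_esum => x _; rewrite setIC EFinM -initial_lawE.
by apply/esym; exact: transition_law.
Qed.

Lemma shift_state_bij s : set_bij setT setT (@shift_state d n s).
Proof.
split=> // [x y _ _|y _]; first exact: (can_inj (shift_stateK s)).
by exists (shift_state (- s) y) => //; rewrite shift_stateVK.
Qed.

Lemma shifted_law_invariant s : kernel_invariant kernel (initial_law \o shift_state s).
Proof.
split=> [x|y /=]; first exact: fine_ge0.
have [_ <-] := initial_law_invariant; rewrite [RHS](reindex_esum _ _ _ _ (shift_state_bij s)).
by apply: eq_esum => x _; rewrite kernel_shift.
Qed.

Hypothesis mu0 : 0 < mu [set 0%N].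

(** With no arrival, every route a departure and a nonempty node [i] served, no queue grows and
    queue [i] loses a job. This event has positive probability: its factors are powers of P(xi = 0)
    and of [q], and the service rate at [i]. *)
Lemma reach_fewer x : (0 < queue_total x)%N ->
  exists2 y, (queue_total y < queue_total x)%N & (0 < kernel x y)%R.
Proof.
move=> x0; have [i xi0] : exists i, (0 < x i)%N.
  case: (pickP (fun i => 0 < x i)%N) => [i|xz]; first by exists i.
  move: x0; rewrite /queue_total big1// => i _; apply/eqP.
  by rewrite -leqn0 leqNgt xz.
pose D : set (state d n) := [set y : state d n | (queue_total y < queue_total x)%N].
pose G := sources_event X xi route setT (fun=> [set 0%N]) (fun=> [set None])
  `&` [set w | served alg x (U 0%N ^~ w) i].
have GD : G `<=` next x @^-1` D.
  move=> w [[[_ wxi] wr] ws] /=; rewrite /D/= /queue_total.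
  have nextE j : next x w j = (x j - served alg x (U 0%N ^~ w) j)%N.
    rewrite /next /next_driver /= next_state_eff ffunE big1 => [|k _].
      by rewrite (wxi j Logic.I) !addn0.
    by rewrite (wr k Logic.I).
  rewrite (bigD1 i)//= [ltnRHS](bigD1 i)//= -addSn leq_add//.
    by rewrite nextE ws subn1 prednK.
  by apply: leq_sum => j _; rewrite nextE leq_subr.
have PG : 0 < P G.
  rewrite (measure_sources_served hmodel) (measure_sources_event hmodel).
  rewrite preimage_setT probability_setT mul1e.
  case/andP: q01 => q0 _.
  have -> : \prod_(i : torus d n) P (route 0%N i @^-1` [set None]) = (\prod_(i : torus d n) q)%:E.
    by rewrite -prodEFin; apply: eq_bigr => j _; rewrite (departure_law hmodel).
  have mufin : mu [set 0%N] \is a fin_num by rewrite fin_num_measure.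
  have -> : \prod_(i : torus d n) mu [set 0%N] = (\prod_(i : torus d n) fine (mu [set 0%N]))%:E.
    by rewrite -prodEFin; apply: eq_bigr => j _; rewrite fineK.
  rewrite -!EFinM lte_fin mulr_gt0//.
    rewrite mulr_gt0// prodr_gt0// => j _.
    by rewrite -lte_fin fineK.
  rewrite divr_gt0 ?ltr0n// (leq_trans xi0)//.
  by rewrite (bigD1 i) ?nbhd_refl//= leq_addr.
have mG : measurable G.
  by apply: measurableI; [exact: (measurable_sources_event hmodel)|exact: measurable_served0].
have PD : 0 < P (next x @^-1` D).
  by apply: lt_le_trans PG _; rewrite le_measure ?inE//; exact: discrete_mfun_next.
(* A sum over smaller states that is positive must have a positive term, which is the required
   successor. *)
apply: contrapT => noy; move: PD; rewrite (measure_fibers P (discrete_mfun_next x)).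
rewrite esum1 ?ltxx// => y Dy; apply: etrans (kernelE x y) _.
apply/eqP; rewrite eqe eq_le kernel_ge0 andbT leNgt; apply/negP => ky.
by apply: noy; exists y.
Qed.

Lemma initial_law_shift s x : initial_law (shift_state s x) = initial_law x.
Proof.
have sz y : queue_total y = 0%N -> y = [ffun=> 0%N].
  move=> /eqP; rewrite /queue_total sum_nat_eq0 => /forallP y0.
  by apply/ffunP => i; rewrite ffunE; apply/eqP; exact: y0.
have -> : initial_law (shift_state s x) = (initial_law \o shift_state s) x by [].
apply: (invariant_unique kernel_ge0 sz reach_fewer kernel_sum1
  (shifted_law_invariant s) initial_law_invariant).
  by rewrite -initial_law_sum1 [RHS](reindex_esum _ _ _ _ (shift_state_bij s)).
exact: initial_law_sum1.
Qed.

Lemma mean_queue_shift i :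
  \int[P]_w ((X 0%N w i)%:R : R)%:E = \int[P]_w ((X 0%N w 0%R)%:R : R)%:E.
Proof.
have mX := discrete_mfun_initial hmodel.
have mS : discrete_mfun (shift_state i \o X 0%N) by exact: discrete_mfun_comp.
have lawE x : P (X 0%N @^-1` [set x]) = P ((shift_state i \o X 0%N) @^-1` [set x]).
  rewrite (_ : (shift_state i \o X 0%N) @^-1` [set x] = X 0%N @^-1` [set shift_state (- i) x]).
    by rewrite !initial_lawE initial_law_shift.
  apply/seteqP; split=> w /=; first by move=> <-; rewrite shift_stateK.
  by move=> ->; rewrite shift_stateVK.
have nn x : 0 <= ((x 0%R)%:R : R)%:E by rewrite lee_fin.
have := eq_law_integral mX mS lawE setT nn; rewrite !preimage_setT => ->.
by apply: eq_integral => w _; rewrite /= ffunE add0r.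
Qed.

End Kernel.

(** A law on the integers that gives no mass to 0 has mean at least 1. *)
Lemma mean_lt1_zero_gt0 (R : realType) (mu : probability nat R) (m1 : R) :
  (\int[mu]_m (m%:R)%:E = m1%:E)%E -> m1 < 1 -> (0 < mu [set 0%N])%E.
Proof.
move=> mean m1lt; rewrite lt_neqAle measure_ge0 andbT; apply/eqP => mu0.
suff : (1 <= m1%:E)%E by rewrite lee_fin leNgt m1lt.
have mN (D : set nat) (f : nat -> \bar R) : measurable_fun D f by [].
have pos : mu [set m | (0 < m)%N] = 1%E.
  rewrite (_ : [set m | _] = ~` [set 0%N]); last first.
    by apply/seteqP; split=> -[|m] //=.
  by rewrite probability_setC// -mu0 sube0.
rewrite -mean -pos -[X in (X <= _)%E]mul1e -integral_cst//.
apply: (@le_trans _ _ (\int[mu]_(m in [set m | (0 < m)%N]) (m%:R)%:E)%E).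
  by apply: ge0_le_integral => // m /= m0; rewrite lee_fin ler1n.
by apply: ge0_subset_integral => // m _; rewrite lee_fin.
Qed.

Theorem theorem9 (R : realType) (d n : nat) (hd : (1 <= d)%N) (hn : (2 <= n)%N)
  (q lambda : R) (hq : 0 < q < 1) (alg : algorithm)
  (mu : probability nat R)
  (hxi2 : ('E_mu[(fun m : nat => m%:R ^+ 2)%R] < +oo)%E)
  (hxi : 'E_mu[(fun m : nat => m%:R)%R]%E = (lambda * q)%:E)
  (hlambda : lambda < (2 * d + 1)%:R^-1)
  (dT : measure_display) (T : measurableType dT) (P : probability T R)
  (X : nat -> T -> state d n)
  (xi : nat -> torus d n -> {RV P >-> nat})
  (U : nat -> torus d n -> {RV P >-> R})
  (route : nat -> torus d n -> T -> option (torus d n))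
  (hmodel : multihop X xi U route alg q mu)
  (hstat : stationary P X) :
  ('E_P[(fun w => (X 0%N w 0)%:R)%R] <=
   ((fine 'E_mu[(fun m : nat => m%:R ^+ 2)%R]
       + 2 * d%:R * (1 - q) * lambda + lambda - 2 * lambda ^+ 2 * q ^+ 2)
    / (2 * q * ((2 * d + 1)%:R^-1 - lambda)))%:E)%E.
Proof.
have mean_mu : (\int[mu]_m (m%:R%R)%:E = (lambda * q)%:E)%E by rewrite -hxi expectation.unlock.
have second_mu : (\int[mu]_m ((m ^ 2)%N%:R%R)%:E
    = (fine 'E_mu[(fun m : nat => m%:R ^+ 2)%R])%:E)%E.
  rewrite fineK; last first.
    by rewrite ge0_fin_numE// expectation.unlock integral_ge0// => m _; rewrite lee_fin exprn_ge0.
  by rewrite expectation.unlock; apply: eq_integral => m _; rewrite natrX.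
have mu0 : (0 < mu [set 0%N])%E.
  apply: (mean_lt1_zero_gt0 mean_mu).
  by apply: lt_trans (m1_lt hd hq mean_mu hlambda) _; rewrite invf_lt1// ltr1n.
have mX := discrete_mfun_initial hmodel.
(* All queues have the same mean, so the number of nodes factors out here and cancels against the
   same factor in the bound. *)
have mean_total : (\int[P]_w ((queue_total (X 0%N w))%:R : R)%:E
    = #|{: torus d n}|%:R%:E * 'E_P[(fun w => (X 0%N w 0)%:R)%R])%E.
  transitivity (\sum_(i in predT) \int[P]_w ((X 0%N w i)%:R : R)%:E)%E.
    apply: (natintegral_sum P measurableT predT) => i.
    exact: (discrete_mfun_comp (fun y : state d n => y i) mX).
  under eq_bigr do rewrite (mean_queue_shift hq hmodel hstat mu0).
  by rewrite expectation.unlock sumr_const mule_natl.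
have := mean_queue_total hd hq hmodel hstat mean_mu second_mu hlambda
  (discrete_mfun_step hmodel).
rewrite mean_total; set e := ('E_P[_])%E; set B := (_ + _ - _).
have e2 : 0 < 2 * (q * ((2 * d + 1)%:R^-1 - lambda)).
  by rewrite !mulr_gt0 ?subr_gt0//; case/andP: hq.
have N0 : 0 < #|{: torus d n}|%:R :> R by rewrite ltr0n; apply/card_gt0P; exists 0.
rewrite muleCA [(_ * B)%:E]EFinM lee_pmul2l ?lte_fin// -lee_pdivlMl// -EFinM.
by rewrite mulrC mulrA.
Qed.
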